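(* Let $\mathsf{M}$ be a paving matroid of rank $k$ on a ground set of cardinality $n$, and for each $h\geq k$ let $\lambda_h$ be the number of hyperplanes of $\mathsf{M}$ of cardinality $h$. Then \[ P_{\mathsf{M}}(t)=P_{\mathsf{U}_{k,n}}(t)-\sum_{h\geq k}\lambda_h\, p_{k,h}(t),\quad Q_{\mathsf{M}}(t)=Q_{\mathsf{U}_{k,n}}(t)-\sum_{h\geq k}\lambda_h\, q_{k,h}(t),\quad Z_{\mathsf{M}}(t)=Z_{\mathsf{U}_{k,n}}(t)-\sum_{h\geq k}\lambda_h\, z_{k,h}(t),\] where $p_{k,h}(t)=P_{\mathsf{U}_{k,h+1}}(t)-P_{\mathsf{U}_{k-1,h}}(t)$, $q_{k,h}(t)=Q_{\mathsf{U}_{k,h+1}}(t)-Q_{\mathsf{U}_{k-1,h}}(t)$ and $z_{k,h}(t)=Z_{\mathsf{U}_{k,h+1}}(t)-(1+t)Z_{\mathsf{U}_{k-1,h}}(t)$.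
   Context: $\mathsf{U}_{k,n}$ denotes the uniform matroid of rank $k$ on $n$ elements. A matroid of rank $k$ is paving if all of its circuits have cardinality at least $k$. A hyperplane is a flat of rank $k-1$. For a matroid $\mathsf{M}$ on $E$ with lattice of flats $\mathscr{L}(\mathsf{M})$ and a flat $F$: $\mathsf{M}^F$ is the localization (the matroid on $F$ whose flats are the flats of $\mathsf{M}$ contained in $F$) and $\mathsf{M}_F$ is the contraction (the matroid on $E\smallsetminus F$ whose flats are $F'\smallsetminus F$ for flats $F'\supseteq F$). $\chi_{\mathsf{M}}$ is the characteristic polynomial. The Kazhdan–Lusztig polynomial $P_{\mathsf{M}}(t)\in\mathbb{Z}[t]$ is the unique assignment such that: if $\operatorname{rk}(\mathsf{M})=0$ then $P_{\mathsf{M}}=1$ if the ground set is empty and $0$ otherwise; if $\operatorname{rk}(\mathsf{M})>0$ then $\deg P_{\mathsf{M}}<\operatorname{rk}(\mathsf{M})/2$; and $t^{\operatorname{rk}(\mathsf{M})}P_{\mathsf{M}}(t^{-1})=\sum_{F\in\mathscr{L}(\mathsf{M})}\chi_{\mathsf{M}^F}(t)P_{\mathsf{M}_F}(t)$. The inverse Kazhdan–Lusztig polynomial $Q_{\mathsf{M}}(t)$ is the unique assignment satisfying the same first two conditions and $(-t)^{\operatorname{rk}(\mathsf{M})}Q_{\mathsf{M}}(t^{-1})=\sum_{F\in\mathscr{L}(\mathsf{M})}(-1)^{\operatorname{rk}(F)}Q_{\mathsf{M}^F}(t)\,t^{\operatorname{rk}(\mathsf{M})-\operatorname{rk}(F)}\chi_{\mathsf{M}_F}(t^{-1})$.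 The $Z$-polynomial is $Z_{\mathsf{M}}(t)=\sum_{F\in\mathscr{L}(\mathsf{M})}t^{\operatorname{rk}(F)}P_{\mathsf{M}_F}(t)$. *)

(* Defs.v *)
From HB Require Import structures.
From mathcomp Require Import all_boot all_order all_algebra.
From mathcomp Require Import zify ring.
Set Implicit Arguments.
Unset Strict Implicit.
Unset Printing Implicit Defensive.
Import Order.TTheory GRing.Theory Num.Theory.
Local Open Scope ring_scope.

(* A matroid on a ground set E inside an ambient finite type T, given by its
   rank function.  Subsets of T are read through their trace on E (first
   clause), so that a matroid is determined by E and the ranks of the subsets
   of E, and so that minors live on the same ambient type. *)
Definition rank_axioms (T : finType) (E : {set T}) (r : {ffun {set T} -> nat}) :=
  [&& [forall A : {set T}, r A == r (A :&: E)],
      [forall A : {set T}, (r A <= #|A|)%N],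
      [forall A : {set T}, forall B : {set T},
         (A \subset B) ==> (r A <= r B)%N]
    & [forall A : {set T}, forall B : {set T},
         (r (A :|: B) + r (A :&: B) <= r A + r B)%N]].

Record matroid (T : finType) := Matroid {
  ground : {set T};
  rank : {ffun {set T} -> nat};
  rankP : rank_axioms ground rank
}.

Section Basic.
Variable T : finType.
Implicit Types (M : matroid T) (A B C F G : {set T}).

Definition rk M := rank M (ground M).

Definition indep M A := (A \subset ground M) && (rank M A == #|A|).

Definition circuit M C :=
  [&& C \subset ground M, ~~ indep M C & [forall x in C, indep M (C :\ x)]].

Definition paving M := forall C, circuit M C -> (rk M <= #|C|)%N.

Definition flat M F :=
  (F \subset ground M) &&
  [forall x in ground M :\: F, (rank M F < rank M (x |: F))%N].

Definition flats M : {set {set T}} := [set F | flat M F].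

(* Written with a successor so that a matroid of rank 0 has no hyperplane. *)
Definition hyperplane M F := flat M F && ((rank M F).+1 == rk M).

Definition num_hyperplanes M (h : nat) : nat :=
  #|[set F : {set T} | hyperplane M F & #|F| == h]|.

Lemma rank_trace M A : rank M (A :&: ground M) = rank M A.
Proof. by case/and4P: (rankP M) => /forallP/(_ A)/eqP<-. Qed.

Lemma rank_card M A : (rank M A <= #|A|)%N.
Proof. by case/and4P: (rankP M) => _ /forallP/(_ A). Qed.

Lemma rank_mono M A B : A \subset B -> (rank M A <= rank M B)%N.
Proof.
by case/and4P: (rankP M) => _ _ /forallP/(_ A)/forallP/(_ B)/implyP.
Qed.

Lemma rank_submod M A B :
  (rank M (A :|: B) + rank M (A :&: B) <= rank M A + rank M B)%N.
Proof. by case/and4P: (rankP M) => _ _ _ /forallP/(_ A)/forallP/(_ B). Qed.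

Lemma matroid_eq M N : ground M = ground N -> rank M =1 rank N -> M = N.
Proof.
case: M N => [E r p] [E' r' p'] /= eqE /ffunP eqr; subst E' r'.
by rewrite (bool_irrelevance p p').
Qed.

Lemma localization_subproof M F :
  rank_axioms (ground M :&: F) [ffun A : {set T} => rank M (A :&: F)].
Proof.
apply/and4P; split; apply/forallP=> A; rewrite ?ffunE.
- apply/eqP; rewrite -rank_trace -[RHS]rank_trace; congr (rank M _).
  by apply/setP=> x; rewrite !inE; do ![case: (_ \in _)].
- exact: leq_trans (rank_card _ _) (subset_leq_card (subsetIl _ _)).
- apply/forallP=> B; rewrite !ffunE; apply/implyP=> sAB.
  by apply: rank_mono; apply: setSI.
- apply/forallP=> B; rewrite !ffunE.
  have -> : (A :|: B) :&: F = (A :&: F) :|: (B :&: F) by rewrite setIUl.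
  have -> : (A :&: B) :&: F = (A :&: F) :&: (B :&: F) by rewrite setIACA setIid.
  exact: rank_submod.
Qed.

Definition localization M F : matroid T := Matroid (localization_subproof M F).

Lemma rank_setU_le M A F : (rank M (A :|: F) <= #|A| + rank M F)%N.
Proof.
have := rank_submod M A F; have := rank_card M A; lia.
Qed.

Lemma contraction_subproof M F :
  rank_axioms (ground M :\: F)
    [ffun A : {set T} => (rank M (A :|: F) - rank M F)%N].
Proof.
have le A : (rank M F <= rank M (A :|: F))%N by rewrite rank_mono ?subsetUr.
apply/and4P; split; apply/forallP=> A; rewrite ?ffunE.
- apply/eqP; congr (_ - _)%N.
  rewrite -rank_trace -[RHS]rank_trace; congr (rank M _).
  by apply/setP=> x; rewrite !inE; do ![case: (_ \in _)].
- by have := rank_setU_le M A F; lia.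
- apply/forallP=> B; rewrite !ffunE; apply/implyP=> sAB.
  by rewrite leq_sub2r // rank_mono // setSU.
- apply/forallP=> B; rewrite !ffunE.
  have := rank_submod M (A :|: F) (B :|: F).
  rewrite -setUIl -setUUl; have := le A; have := le B.
  have := le (A :|: B); have := le (A :&: B); lia.
Qed.

Definition contraction M F : matroid T := Matroid (contraction_subproof M F).

Definition charpoly M : {poly int} :=
  \sum_(A : {set T} | A \subset ground M)
     (-1) ^+ #|A| *: 'X^(rk M - rank M A).

End Basic.

Lemma uniform_subproof (k n : nat) :
  rank_axioms [set: 'I_n] [ffun A : {set 'I_n} => minn #|A| k].
Proof.
apply/and4P; split; apply/forallP=> A; rewrite ?ffunE ?setIT ?geq_minl //.
- apply/forallP=> B; rewrite !ffunE; apply/implyP=> /subset_leq_card; lia.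
- apply/forallP=> B; rewrite !ffunE.
  have := cardsUI A B; have := subset_leq_card (subsetIl A B).
  have := subset_leq_card (subsetIr A B); lia.
Qed.

Definition uniform (k n : nat) : matroid 'I_n := Matroid (uniform_subproof k n).

(* t^r p(1/t), for p of degree at most r. *)
Definition reversal (r : nat) (p : {poly int}) : {poly int} :=
  \sum_(i < r.+1) p`_i *: 'X^(r - i).

Definition matroid_invariant := forall T : finType, matroid T -> {poly int}.

Definition KL_rank0 (P : matroid_invariant) :=
  forall (T : finType) (M : matroid T),
    rk M = 0%N -> P T M = if ground M == set0 then 1 else 0.

(* (size p).-1 is the degree of p if p != 0, and 0 if p = 0. *)
Definition KL_degree (P : matroid_invariant) :=
  forall (T : finType) (M : matroid T),
    (0 < rk M)%N -> ((size (P T M)).-1.*2 < rk M)%N.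

Definition is_KL (P : matroid_invariant) :=
  [/\ KL_rank0 P, KL_degree P
    & forall (T : finType) (M : matroid T),
        reversal (rk M) (P T M) =
        \sum_(F in flats M)
           charpoly (localization M F) * P T (contraction M F)].

Definition is_inverse_KL (Q : matroid_invariant) :=
  [/\ KL_rank0 Q, KL_degree Q
    & forall (T : finType) (M : matroid T),
        (-1) ^+ rk M *: reversal (rk M) (Q T M) =
        \sum_(F in flats M)
           (-1) ^+ rank M F *: (Q T (localization M F) *
             reversal (rk M - rank M F) (charpoly (contraction M F)))].

Section Minors.
Variable T : finType.
Implicit Types (M : matroid T) (A B C D F G : {set T}).

Lemma setDUK F G : F \subset G -> G :\: F :|: F = G.
Proof.
move=> sFG; apply/setP=> x; rewrite !inE.
by case: (boolP (x \in F)) => [/(subsetP sFG) ->|_]; rewrite ?orbT ?orbF.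
Qed.

Lemma flat_sub M F : F \in flats M -> F \subset ground M.
Proof. by rewrite inE => /andP[]. Qed.

Lemma ground_flat M : ground M \in flats M.
Proof.
by rewrite inE /flat subxx /=; apply/forallP=> x; rewrite setDv inE.
Qed.

Lemma rank_localization M F A : A \subset F ->
  rank (localization M F) A = rank M A.
Proof. by move=> sAF; rewrite ffunE (setIidPl sAF). Qed.

Lemma ground_localization M F : F \subset ground M ->
  ground (localization M F) = F.
Proof. by move/setIidPr. Qed.

Lemma rk_localization M F : F \subset ground M ->
  rk (localization M F) = rank M F.
Proof.
by move=> sF; rewrite /rk ground_localization // rank_localization.
Qed.

Lemma rank_contraction M F A :
  rank (contraction M F) A = (rank M (A :|: F) - rank M F)%N.
Proof. by rewrite ffunE. Qed.

Lemma rk_contraction M F : F \subset ground M ->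
  rk (contraction M F) = (rk M - rank M F)%N.
Proof. by move=> sF; rewrite /rk rank_contraction /= setDUK. Qed.

Lemma flats_localization M F : F \in flats M ->
  flats (localization M F) = [set G in flats M | G \subset F].
Proof.
move=> fF; have sF := flat_sub fF.
apply/setP=> G; rewrite !inE /flat ground_localization //.
have [sGF|nsGF] := boolP (G \subset F); last by rewrite andbF.
rewrite (subset_trans sGF sF) /= andbT.
apply/forallP/forallP => /= H x; have := H x; rewrite !inE.
- move=> Hx; apply/implyP=> /andP[xG xE]; have [xF|xF] := boolP (x \in F).
    move: Hx; rewrite xG xF /= !ffunE (setIidPl sGF).
    by rewrite (setIidPl _) // subUset sub1set xF.
  move: fF; rewrite inE => /andP[_ /forallP/(_ x)].
  rewrite !inE xF xE /= => ltx.
  have := rank_submod M (x |: G) F.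
  rewrite -setUA (setUidPr sGF).
  have -> : (x |: G) :&: F = G.
    by apply/setP=> y; rewrite !inE; case: eqP => [->|_] /=;
      rewrite ?(negPf xF) ?(negPf xG) //; apply/andb_idr/(subsetP sGF).
  lia.
- move=> Hx; apply/implyP=> /andP[xG xF]; move: Hx.
  rewrite xG (subsetP sF _ xF) /= !ffunE (setIidPl sGF).
  by rewrite (setIidPl _) // subUset sub1set xF.
Qed.

Lemma flats_contraction_in M F G : F \subset ground M -> [disjoint G & F] ->
  (G \in flats (contraction M F)) = (G :|: F \in flats M).
Proof.
move=> sF dGF; rewrite !inE /flat /= subsetD dGF andbT subUset sF andbT.
congr (_ && _); apply: eq_forallb => x; rewrite !inE !negb_or.
rewrite -!andbA; case: (x \in G) => //=; case: (x \in F) => //=.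
case: (x \in ground M) => //=; rewrite !ffunE setUA.
rewrite ltn_sub2rE // rank_mono // subsetUr //.
Qed.

Lemma flats_contraction M F : F \in flats M ->
  flats (contraction M F) = [set G :\: F | G in flats M & F \subset G].
Proof.
move=> fF; have sF := flat_sub fF; apply/setP=> G; apply/idP/imsetP.
- move=> fG; have := flat_sub fG; rewrite subsetD => /andP[_ dGF].
  exists (G :|: F); last first.
    by rewrite setDUl setDv setU0; apply/esym/setDidPl.
  by rewrite inE -flats_contraction_in // fG subsetUr.
- case=> H; rewrite inE => /andP[fH sFH] ->.
  rewrite flats_contraction_in //; last by rewrite disjoint_sym disjoints_subset setCD subsetUr.
  by rewrite setDUK.
Qed.

End Minors.
Lemma coef_reversal r p i : (reversal r p)`_i = if (i <= r)%N then p`_(r - i) else 0.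
Proof.
rewrite /reversal coef_sum; case: leqP => ir.
  have lt : (r - i < r.+1)%N by rewrite ltnS leq_subr.
  rewrite (bigD1 (Ordinal lt)) //= coefZ coefXn subKn // eqxx mulr1.
  rewrite big1 ?addr0 // => j ne; rewrite coefZ coefXn.
  case: eqP => [e|_]; last by rewrite mulr0.
  case/eqP: ne; apply/val_inj => /=; have := ltn_ord j; lia.
rewrite big1 // => j _; rewrite coefZ coefXn.
by case: eqP => [e|_]; [have := ltn_ord j; lia | rewrite mulr0].
Qed.

Lemma reversalD r p q : reversal r (p + q) = reversal r p + reversal r q.
Proof.
by apply/polyP=> i; rewrite coefD !coef_reversal coefD; case: leqP; rewrite ?addr0.
Qed.

Lemma reversalZ r c p : reversal r (c *: p) = c *: reversal r p.
Proof.
by apply/polyP=> i; rewrite coefZ !coef_reversal coefZ; case: leqP; rewrite ?mulr0.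
Qed.

Lemma reversal0 r : reversal r 0 = 0.
Proof. by rewrite -[0 in LHS](scale0r 0) reversalZ scale0r. Qed.

Lemma reversal_sum r (I : Type) (s : seq I) (P : pred I) (f : I -> {poly int}) :
  reversal r (\sum_(i <- s | P i) f i) = \sum_(i <- s | P i) reversal r (f i).
Proof. exact: (big_morph _ (reversalD r) (reversal0 r)). Qed.

Lemma reversalXn r i : (i <= r)%N -> reversal r 'X^i = 'X^(r - i).
Proof.
move=> ir; apply/polyP=> j; rewrite coef_reversal !coefXn.
by case: leqP => jr; do 2?[case: eqP => //]; lia.
Qed.

Lemma reversalK r (p : {poly int}) : (size p <= r.+1)%N -> reversal r (reversal r p) = p.
Proof.
move=> sp; apply/polyP=> i; rewrite !coef_reversal leq_subr.
by case: leqP => ir; [rewrite subKn | rewrite nth_default // (leq_trans sp)].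
Qed.

Lemma size_reversal r p : (size (reversal r p) <= r.+1)%N.
Proof.
by apply/leq_sizeP=> i ir; rewrite coef_reversal leqNgt ir.
Qed.

Lemma poly_widen r (p : {poly int}) : (size p <= r.+1)%N ->
  p = \sum_(i < r.+1) p`_i *: 'X^i.
Proof.
move=> sp; rewrite -poly_def; apply/polyP=> i; rewrite coef_poly.
by case: ltnP => // ir; rewrite nth_default // (leq_trans sp).
Qed.

Lemma reversalM a b (p q : {poly int}) : (size p <= a.+1)%N -> (size q <= b.+1)%N ->
  reversal (a + b) (p * q) = reversal a p * reversal b q.
Proof.
move=> sp sq; rewrite {1}(poly_widen sp) {1}(poly_widen sq).
rewrite /(reversal a p) /(reversal b q) !big_distrl /= reversal_sum.
apply: eq_bigr => i _; rewrite !big_distrr /= reversal_sum.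
apply: eq_bigr => j _.
rewrite -!scalerAl -!scalerAr !scalerA -!exprD reversalZ.
have := ltn_ord i; have := ltn_ord j => lj li.
rewrite reversalXn; last by lia.
by congr (_ *: 'X^_); lia.
Qed.

Lemma polyint_eq_opp (p : {poly int}) : p = - p -> p = 0.
Proof.
by move=> e; apply/polyP=> i; have := congr1 (fun q : {poly int} => q`_i) e;
  rewrite /= coefN coef0; move: p`_i => c; lia.
Qed.

Section Toggle.
Variables (T : finType) (x : T).
Implicit Types A : {set T}.
Definition toggle A := if x \in A then A :\ x else x |: A.

Lemma toggleK : involutive toggle.
Proof.
move=> A; rewrite /toggle; case: (boolP (x \in A)) => xA.
  by rewrite !inE eqxx setD1K.
by rewrite !inE eqxx setU1K.
Qed.

Lemma sign_toggle A : (-1) ^+ #|toggle A| = - (-1) ^+ #|A| :> int.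
Proof.
rewrite /toggle; case: ifP => xA.
  by rewrite (cardsD1 x A) xA exprS mulN1r opprK.
by rewrite cardsU1 xA exprS mulN1r.
Qed.

Lemma sum_toggle (P : pred {set T}) (f : {set T} -> {poly int}) :
  (forall A, P (toggle A) = P A) ->
  (forall A, P A -> f (toggle A) = - f A) ->
  \sum_(A | P A) f A = 0.
Proof.
move=> Pt ft; apply: polyint_eq_opp.
rewrite {1}(reindex_inj (inv_inj toggleK)) /= -sumrN.
by apply: eq_big => [A|A]; rewrite ?Pt // => PA; rewrite ft // -Pt.
Qed.
End Toggle.

Section Kernel.
Variable T : finType.
Implicit Types (M : matroid T) (A B C D F G : {set T}).

Lemma toggle_sub (x : T) A D : x \in D -> (toggle x A \subset D) = (A \subset D).
Proof.
move=> xD; rewrite /toggle; case: ifP => xA; last by rewrite subUset sub1set xD.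
by rewrite -{2}(setD1K xA) subUset sub1set xD.
Qed.

Lemma sign_sum A : \sum_(B : {set T} | B \subset A) (-1) ^+ #|B| *: 1
  = (A == set0)%:R :> {poly int}.
Proof.
have [->|[x xA]] := set_0Vmem A.
  rewrite (eq_bigl (pred1 set0)) => [|B]; last by rewrite subset0.
  by rewrite big_pred1_eq cards0 eqxx scale1r.
rewrite (sum_toggle (x := x)) => [|B|B _].
- by case: eqP => // e; rewrite e inE in xA.
- by rewrite toggle_sub.
- by rewrite sign_toggle scaleNr.
Qed.

Lemma charpoly_contraction_raw M F : F \subset ground M ->
  charpoly (contraction M F) =
  \sum_(B : {set T} | B \subset ground M :\: F)
     (-1) ^+ #|B| *: 'X^(rk M - rank M (B :|: F)).
Proof.
move=> sF; apply: eq_bigr => B sB; rewrite rk_contraction // rank_contraction.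
congr (_ *: 'X^_).
have : (rank M F <= rank M (B :|: F))%N by rewrite rank_mono ?subsetUr.
lia.
Qed.

Lemma charpoly_contraction M F : F \subset ground M ->
  charpoly (contraction M F) =
  \sum_(D : {set T} | (F \subset D) && (D \subset ground M))
     (-1) ^+ #|D :\: F| *: 'X^(rk M - rank M D).
Proof.
move=> sF; rewrite charpoly_contraction_raw //.
rewrite (reindex_onto (fun D => D :\: F) (fun B => B :|: F)) /=; last first.
  by move=> B; rewrite subsetD => /andP[_ /setDidPl]; rewrite setDUl setDv setU0.
apply: eq_big => D.
  apply/andP/andP => -[].
    move=> sD /eqP e; split; first by rewrite -e subsetUr.
    by rewrite -e subUset sF andbT (subset_trans sD) ?subsetDl.
  by move=> sFD sD; rewrite setSD // setDUK.
by case/andP=> _ /eqP->.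
Qed.

Lemma charpoly_contraction_nonflat M F :
  F \subset ground M -> F \notin flats M -> charpoly (contraction M F) = 0.
Proof.
move=> sF; rewrite inE /flat sF /= negb_forall => /existsP[x].
rewrite negb_imply inE -leqNgt => /andP[/andP[xF xE] le].
rewrite charpoly_contraction_raw //; apply: (sum_toggle (x := x)) => [B|B sB].
  by rewrite toggle_sub // inE xF.
rewrite sign_toggle scaleNr; congr (- (_ *: 'X^(_ - _))).
have H C : rank M (x |: C :|: F) = rank M (C :|: F).
  apply/eqP; rewrite eqn_leq [X in _ && X]rank_mono ?setSU ?subsetUr // andbT.
  have := rank_submod M (C :|: F) (x |: F).
  have -> : C :|: F :|: (x |: F) = x |: C :|: F.
    by apply/setP=> y; rewrite !inE; do ![case: (_ \in _) | case: (_ == _)].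
  have : (rank M F <= rank M ((C :|: F) :&: (x |: F)))%N.
    by rewrite rank_mono // subsetI !subsetUr.
  lia.
rewrite /toggle; case: ifP => xB; last exact: H.
by rewrite -{2}(setD1K xB) H.
Qed.

Lemma sum_charpoly_contraction M C : C \subset ground M ->
  \sum_(F in flats M | C \subset F) charpoly (contraction M F)
  = 'X^(rk M - rank M C).
Proof.
move=> sC.
transitivity (\sum_(F : {set T} | (C \subset F) && (F \subset ground M))
   charpoly (contraction M F)).
  rewrite [RHS](bigID (mem (flats M))) /= [X in _ + X]big1 ?addr0; last first.
    by move=> F /andP[/andP[_ sF] nF]; apply: charpoly_contraction_nonflat.
  apply: eq_bigl => F; rewrite andbC.
  by case: (boolP (F \in flats M)) => [/flat_sub->|_]; rewrite ?andbT ?andbF.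
under eq_bigr => F /andP[_ sF] do rewrite charpoly_contraction //.
rewrite (exchange_big_dep (fun D => (C \subset D) && (D \subset ground M))) /=;
  last first.
  by move=> F D /andP[sCF _] /andP[sFD ->]; rewrite (subset_trans sCF).
rewrite (bigD1 C) /= ?subxx ?sC // [X in _ + X]big1 ?addr0.
  rewrite (eq_bigl (pred1 C)) ?big_pred1_eq ?setDv ?cards0 ?scale1r // => F /=.
  rewrite ?sC ?andbT eqEsubset.
  by case: (boolP (F \subset C)) => [sFC|_]; rewrite ?andbF // (subset_trans sFC sC) !andbT.
move=> D /andP[/andP[sCD sD] neDC].
have [x] : exists x, x \in D :\: C.
  apply/set0Pn; rewrite setD_eq0; apply: contraNN neDC => sDC.
  by rewrite eqEsubset sDC.
rewrite inE => /andP[xC xD].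
apply: (sum_toggle (x := x)) => F.
  rewrite !toggle_sub ?(subsetP sD) //; congr (_ && _ && _).
  rewrite /toggle; case: ifP => xF; first by rewrite subsetD1 xC andbT.
  apply/idP/idP => [/subsetP s|s]; last exact: subset_trans s (subsetUr _ _).
  apply/subsetP=> y yC; have := s _ yC; rewrite !inE => /predU1P[e|//].
  by rewrite -e yC in xC.
move=> _; rewrite -scaleNr; congr (_ *: _).
have -> : D :\: toggle x F = toggle x (D :\: F).
  apply/setP=> y; rewrite /toggle !inE xD andbT.
  case: (boolP (x \in F)) => xF; rewrite !inE /=; case: eqP => [->|_] /=;
    by rewrite ?xD ?xF ?andbF ?andbT.
exact: sign_toggle.
Qed.

Lemma reversal_charpoly_localization M F : F \subset ground M ->
  reversal (rank M F) (charpoly (localization M F)) =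
  \sum_(C : {set T} | C \subset F) (-1) ^+ #|C| *: 'X^(rank M C).
Proof.
move=> sF; rewrite /charpoly ground_localization // rk_localization //.
rewrite reversal_sum; apply: eq_bigr => C sC; rewrite reversalZ.
have le := rank_mono M sC.
by rewrite reversalXn ?leq_subr // rank_localization // subKn.
Qed.

Lemma charpoly_kernel M :
  \sum_(F in flats M) reversal (rank M F) (charpoly (localization M F)) *
     charpoly (contraction M F) = (ground M == set0)%:R.
Proof.
under eq_bigr => F fF do
  rewrite reversal_charpoly_localization ?flat_sub // big_distrl /=.
rewrite (exchange_big_dep (fun C : {set T} => C \subset ground M)) /=; last first.
  by move=> F C /flat_sub sF sC; apply: subset_trans sC sF.
transitivity (\sum_(C : {set T} | C \subset ground M)
   (-1) ^+ #|C| *: (1 : {poly int}) * 'X^(rk M)).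
  apply: eq_bigr => C sC; rewrite -big_distrr /= sum_charpoly_contraction //.
  rewrite -!scalerAl mul1r -exprD subnKC // rank_mono //.
rewrite -big_distrl /= sign_sum; case: eqP => [e|_]; last by rewrite mul0r.
by rewrite mul1r /rk e (_ : rank M set0 = 0%N) //; have := rank_card M set0; rewrite cards0; lia.
Qed.

End Kernel.
Section MinorsOfMinors.
Variable T : finType.
Implicit Types (M : matroid T) (A B C D F G : {set T}).

Lemma localization_localization M F G : F \subset G ->
  localization (localization M G) F = localization M F.
Proof.
move=> sFG; apply: matroid_eq => [|A] /=.
  by rewrite -setIA (setIidPr sFG).
by rewrite !ffunE -setIA (setIidPl sFG).
Qed.

Lemma contraction_contraction M F G : F \subset G ->
  contraction (contraction M F) (G :\: F) = contraction M G.
Proof.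
move=> sFG; have GF := setDUK sFG; apply: matroid_eq => [|A] /=.
  by rewrite setDDl setUC GF.
rewrite !ffunE -setUA GF.
have : (rank M F <= rank M G)%N by exact: rank_mono.
have : (rank M G <= rank M (A :|: G))%N by rewrite rank_mono ?subsetUr.
lia.
Qed.

Lemma localization_contraction M F G : F \subset G ->
  localization (contraction M F) (G :\: F) = contraction (localization M G) F.
Proof.
move=> sFG; apply: matroid_eq => [|A] /=.
  by apply/setP=> x; rewrite !inE; do ![case: (_ \in _)].
rewrite !ffunE (setIidPl sFG); congr (rank M _ - _)%N; apply/setP=> x.
rewrite !inE; case: (boolP (x \in F)) => [/(subsetP sFG)->|_];
  by rewrite ?orbT ?orbF ?andbT.
Qed.

Lemma localization_ground M : localization M (ground M) = M.
Proof.
by apply: matroid_eq => [|A] /=; rewrite ?setIid // ffunE rank_trace.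
Qed.

Lemma contraction_set0 M : contraction M set0 = M.
Proof.
apply: matroid_eq => [|A] /=; rewrite ?setD0 // ffunE setU0.
by have := rank_card M set0; rewrite cards0; lia.
Qed.

Lemma charpoly_empty M : ground M = set0 -> charpoly M = 1.
Proof.
move=> E0; rewrite /charpoly /rk E0 (eq_bigl (pred1 set0)) => [|B].
  by rewrite big_pred1_eq cards0 subnn scale1r.
by rewrite subset0.
Qed.

Lemma size_charpoly M : (size (charpoly M) <= (rk M).+1)%N.
Proof.
apply/(leq_trans (size_sum _ _ _))/bigmax_leqP => A _.
apply: leq_trans (size_scale_leq _ _) _; rewrite size_polyXn ltnS.
exact: leq_subr.
Qed.

Lemma charpoly_loops M F : set0 \notin flats M -> F \in flats M ->
  charpoly (localization M F) = 0.
Proof.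
move=> n0 fF; rewrite -(contraction_set0 (localization M F)).
apply: charpoly_contraction_nonflat; first exact: sub0set.
by rewrite flats_localization // inE (negPf n0).
Qed.

Lemma sum_flats_contraction M F (f : {set T} -> {poly int}) : F \in flats M ->
  \sum_(G in flats (contraction M F)) f G =
  \sum_(G in flats M | F \subset G) f (G :\: F).
Proof.
move=> fF; rewrite flats_contraction // big_imset /=.
  by apply: eq_bigl => G; rewrite inE.
move=> G H; rewrite !inE => /andP[_ sG] /andP[_ sH] e.
by rewrite -(setDUK sG) -(setDUK sH) e.
Qed.

Lemma rank_flat_lt M F : F \in flats M -> F != ground M -> (rank M F < rk M)%N.
Proof.
move=> fF ne; have sF := flat_sub fF.
have [x xEF] : exists x, x \in ground M :\: F.
  apply/set0Pn; rewrite setD_eq0; apply: contraNN ne => sE.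
  by rewrite eqEsubset sF.
have [xF xE] := setDP xEF.
move: fF; rewrite inE => /andP[_ /forallP/(_ x)]; rewrite xEF /=.
by move/leq_trans; apply; rewrite rank_mono // subUset sub1set xF.
Qed.

End MinorsOfMinors.

Lemma truncation_solution r (S : {poly int}) : reversal r S = - S ->
  reversal r (- take_poly (uphalf r) S) = - take_poly (uphalf r) S + S.
Proof.
move=> rS; apply/polyP=> i.
have := congr1 (fun q : {poly int} => q`_i) rS.
rewrite /= coefD !coefN !coef_reversal !coefN !coef_take_poly.
have ab : i = (r - i)%N -> S`_i = S`_(r - i) by move=> {1}->.
move: S`_i (S`_(r - i)) ab => a b ab.
have [ir|ir] := leqP i r; have [h1|h1] := ltnP i (uphalf r);
  have [h2|h2] := ltnP (r - i) (uphalf r); lia.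
Qed.

Lemma truncation_degree r (S : {poly int}) : (0 < r)%N ->
  ((size (- take_poly (uphalf r) S)).-1.*2 < r)%N.
Proof.
move=> r0; have : (size (- take_poly (uphalf r) S) <= uphalf r)%N.
  by rewrite size_polyN size_take_poly.
by move: (size _) => s; lia.
Qed.

Section Existence.
Variable T : finType.
Implicit Types (M : matroid T) (A B C D F G : {set T}).

Fixpoint KL_rec (m : nat) M : {poly int} :=
  if m is m'.+1 then
    if rk M == 0%N then (if ground M == set0 then 1 else 0) else
    - take_poly (uphalf (rk M)) (\sum_(F in flats M | F != set0)
         charpoly (localization M F) * KL_rec m' (contraction M F))
  else 0.

Lemma KL_rec_stable m m' M : (#|ground M| < m)%N -> (#|ground M| < m')%N ->
  KL_rec m M = KL_rec m' M.
Proof.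
elim: m m' M => [|m IH] [|m'] M //= lt lt'; case: ifP => // _.
congr (- take_poly _ _); apply: eq_bigr => F /andP[/flat_sub sF F0].
have lt2 : (#|ground (contraction M F)| < #|ground M|)%N.
  rewrite /= cardsD (setIidPr sF) ltn_subrL.
  rewrite !card_gt0 F0 /=; apply: contraNneq F0 => e.
  by move: sF; rewrite e subset0.
congr (_ * _); apply: IH; lia.
Qed.

End Existence.
Lemma reversal01 : reversal 0 1 = 1.
Proof. by rewrite -(expr0 'X) reversalXn. Qed.

Section KLExistence.
Variable T : finType.
Implicit Types (M : matroid T) (A B C D F G : {set T}).

Definition KL_fun M := KL_rec #|ground M|.+1 M.

Lemma card_contraction_lt M F : F \in flats M -> F != set0 ->
  (#|ground (contraction M F)| < #|ground M|)%N.
Proof.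
move=> /flat_sub sF F0; rewrite /= cardsD (setIidPr sF) ltn_subrL.
rewrite !card_gt0 F0 /=; apply: contraNneq F0 => e.
by move: sF; rewrite e subset0.
Qed.

Lemma KL_fun_eq M : KL_fun M =
  if rk M == 0%N then (if ground M == set0 then 1 else 0) else
    - take_poly (uphalf (rk M)) (\sum_(F in flats M | F != set0)
         charpoly (localization M F) * KL_fun (contraction M F)).
Proof.
rewrite {1}/KL_fun /=; case: ifP => // _.
congr (- take_poly _ _); apply: eq_bigr => F /andP[fF F0].
by congr (_ * _); apply: KL_rec_stable; rewrite ?card_contraction_lt.
Qed.

Lemma KL_fun_rank0 M : rk M = 0%N ->
  KL_fun M = if ground M == set0 then 1 else 0.
Proof. by move=> r0; rewrite KL_fun_eq r0. Qed.

Lemma KL_fun_degree M : (0 < rk M)%N -> ((size (KL_fun M)).-1.*2 < rk M)%N.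
Proof.
by move=> r0; rewrite KL_fun_eq -[_ == _]negbK -lt0n r0; apply: truncation_degree.
Qed.

Lemma size_KL_fun M : (size (KL_fun M) <= (rk M).+1)%N.
Proof.
have [r0|r0] := posnP (rk M); last by have := KL_fun_degree r0; lia.
by rewrite KL_fun_rank0 //; case: ifP => _; rewrite ?size_poly1 ?size_poly0.
Qed.

Lemma rank_set0 M : rank M set0 = 0%N.
Proof. by have := rank_card M set0; rewrite cards0; lia. Qed.

Lemma KL_fun_reversal M : reversal (rk M) (KL_fun M) =
  \sum_(F in flats M) charpoly (localization M F) * KL_fun (contraction M F).
Proof.
have [m] := ubnP #|ground M|; elim: m M => // m IH M ltm.
have [f0|n0] := boolP (set0 \in flats M); last first.
  rewrite big1 => [|F fF]; last by rewrite charpoly_loops ?mul0r.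
  rewrite (_ : KL_fun M = 0) ?reversal0 // KL_fun_eq big1 => [|F /andP[fF _]].
    rewrite take_poly0r oppr0; case: ifP => // _; case: eqP => // E0.
    by rewrite -E0 ground_flat in n0.
  by rewrite charpoly_loops ?mul0r.
rewrite (bigD1 set0) //= contraction_set0 charpoly_empty ?mul1r; last first.
  by rewrite ground_localization ?sub0set.
have [r0|rpos] := posnP (rk M).
  have E0 : ground M = set0.
    apply/eqP/contraT=> ne; have := rank_flat_lt f0.
    by rewrite eq_sym r0 => /(_ ne).
  rewrite big1 ?addr0 => [|F /andP[/flat_sub]]; last first.
    by rewrite E0 subset0 => /eqP->; rewrite eqxx.
  rewrite KL_fun_rank0 // E0 eqxx r0.
  exact: reversal01.
rewrite KL_fun_eq -[_ == _]negbK -lt0n rpos /=; apply: truncation_solution.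
rewrite reversal_sum -sumrN.
transitivity (\sum_(F in flats M | F != set0) \sum_(G in flats M | F \subset G)
   reversal (rank M F) (charpoly (localization M F)) *
     (charpoly (contraction (localization M G) F) * KL_fun (contraction M G))).
  apply: eq_bigr => F /andP[fF F0]; have sF := flat_sub fF.
  have le : (rank M F <= rk M)%N by exact: rank_mono.
  rewrite -{1}(subnKC le) reversalM; first last.
  - by rewrite -rk_contraction // size_KL_fun.
  - by rewrite -rk_localization // size_charpoly.
  rewrite -rk_contraction // IH; last first.
    by have := card_contraction_lt fF F0; lia.
  rewrite sum_flats_contraction // big_distrr /=; apply: eq_bigr => G /andP[_ sFG].
  by rewrite localization_contraction // contraction_contraction.
rewrite (exchange_big_dep (fun G => (G \in flats M) && (G != set0))) /=; last first.
  move=> F G /andP[_ F0] /andP[-> sFG] /=; apply: contraNneq F0 => G0.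
  by rewrite -subset0 -G0.
apply: eq_bigr => G /andP[fG G0]; have sG := flat_sub fG.
under eq_bigr => F _ do rewrite mulrA.
rewrite -big_distrl -mulNr /=; congr (_ * _).
have := charpoly_kernel (localization M G).
rewrite ground_localization // (negPf G0) (bigD1 set0) /=; last first.
  by rewrite flats_localization // inE f0 sub0set.
rewrite contraction_set0 ffunE set0I rank_set0 (charpoly_empty (M := localization (localization M G) set0));
  last by rewrite ground_localization ?sub0set.
rewrite reversal01 mul1r => /eqP; rewrite addrC addr_eq0 => /eqP <-.
rewrite flats_localization //; apply: eq_big => F.
  move: fG; rewrite !inE => ->.
  by case: (flat M F); case: (F \subset G); case: (F == set0).
case/andP=> /andP[fF _] /andP[_ sFG].
by rewrite ffunE (setIidPl sFG) localization_localization.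
Qed.

End KLExistence.

Section InverseKLExistence.
Variable T : finType.
Implicit Types (M : matroid T) (A B C D F G : {set T}).

(* (-1)^rk M * Q_M satisfies an equation of the same shape as the one for P. *)
Fixpoint sQ_rec (m : nat) M : {poly int} :=
  if m is m'.+1 then
    if rk M == 0%N then (if ground M == set0 then 1 else 0) else
    - take_poly (uphalf (rk M)) (\sum_(F in flats M | F != ground M)
         sQ_rec m' (localization M F) *
         reversal (rk M - rank M F) (charpoly (contraction M F)))
  else 0.

Lemma card_localization_lt M F : F \in flats M -> F != ground M ->
  (#|ground (localization M F)| < #|ground M|)%N.
Proof.
move=> /flat_sub sF F0; rewrite ground_localization //; apply: proper_card.
by rewrite properEneq F0.
Qed.

Lemma sQ_rec_stable m m' M : (#|ground M| < m)%N -> (#|ground M| < m')%N ->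
  sQ_rec m M = sQ_rec m' M.
Proof.
elim: m m' M => [|m IH] [|m'] M //= lt lt'; case: ifP => // _.
congr (- take_poly _ _); apply: eq_bigr => F /andP[fF FE].
have lt2 := card_localization_lt fF FE.
congr (_ * _); apply: IH; lia.
Qed.

Definition sQ_fun M := sQ_rec #|ground M|.+1 M.

Lemma sQ_fun_eq M : sQ_fun M =
  if rk M == 0%N then (if ground M == set0 then 1 else 0) else
    - take_poly (uphalf (rk M)) (\sum_(F in flats M | F != ground M)
         sQ_fun (localization M F) *
         reversal (rk M - rank M F) (charpoly (contraction M F))).
Proof.
rewrite {1}/sQ_fun /=; case: ifP => // _.
congr (- take_poly _ _); apply: eq_bigr => F /andP[fF FE].
by congr (_ * _); apply: sQ_rec_stable => //; apply: card_localization_lt.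
Qed.

Lemma sQ_fun_rank0 M : rk M = 0%N ->
  sQ_fun M = if ground M == set0 then 1 else 0.
Proof. by move=> r0; rewrite sQ_fun_eq r0. Qed.

Lemma sQ_fun_degree M : (0 < rk M)%N -> ((size (sQ_fun M)).-1.*2 < rk M)%N.
Proof.
by move=> r0; rewrite sQ_fun_eq -[_ == _]negbK -lt0n r0; apply: truncation_degree.
Qed.

Lemma size_sQ_fun M : (size (sQ_fun M) <= (rk M).+1)%N.
Proof.
have [r0|r0] := posnP (rk M); last by have := sQ_fun_degree r0; lia.
by rewrite sQ_fun_rank0 //; case: ifP => _; rewrite ?size_poly1 ?size_poly0.
Qed.

Lemma sQ_fun_reversal M : reversal (rk M) (sQ_fun M) =
  \sum_(F in flats M) sQ_fun (localization M F) *
     reversal (rk M - rank M F) (charpoly (contraction M F)).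
Proof.
have [m] := ubnP #|ground M|; elim: m M => // m IH M ltm.
rewrite (bigD1 (ground M)) ?ground_flat //= localization_ground subnn.
rewrite charpoly_empty; last exact: setDv.
rewrite reversal01 mulr1.
have [r0|rpos] := posnP (rk M).
  rewrite big1 ?addr0 => [|F /andP[fF FE]]; last first.
    by have := rank_flat_lt fF FE; rewrite r0.
  apply/polyP=> i; rewrite coef_reversal r0.
  case: i => [|i] //=; rewrite nth_default //.
  by apply: leq_trans (size_sQ_fun M) _; rewrite r0.
rewrite sQ_fun_eq -[_ == _]negbK -lt0n rpos /=; apply: truncation_solution.
rewrite reversal_sum -sumrN.
transitivity (\sum_(F in flats M | F != ground M) \sum_(G in flats M | G \subset F)
   sQ_fun (localization M G) *
     (reversal (rank M F - rank M G) (charpoly (contraction (localization M F) G)) *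
      charpoly (contraction M F))).
  apply: eq_bigr => F /andP[fF FE]; have sF := flat_sub fF.
  have le : (rank M F <= rk M)%N by exact: rank_mono.
  rewrite -{1}(subnKC le) reversalM ?size_reversal //; last first.
    by rewrite -rk_localization // size_sQ_fun.
  rewrite reversalK; last by rewrite -rk_contraction // size_charpoly.
  rewrite -rk_localization // IH; last first.
    by have := card_localization_lt fF FE; lia.
  rewrite big_distrl /= flats_localization //; apply: eq_big => [G|G].
    by rewrite inE.
  rewrite inE => /andP[_ sGF].
  by rewrite localization_localization // rank_localization // mulrA.
rewrite (exchange_big_dep (fun G => (G \in flats M) && (G != ground M))) /=; last first.
  move=> F G /andP[/flat_sub sF FE] /andP[-> sGF] /=.
  apply: contraNneq FE => GE.
  by rewrite eqEsubset sF -GE.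
apply: eq_bigr => G /andP[fG GE]; have sG := flat_sub fG.
rewrite -big_distrr -mulrN /=; congr (_ * _).
have := charpoly_kernel (contraction M G).
rewrite sum_flats_contraction // (bigD1 (ground M)) /=; last first.
  by rewrite ground_flat.
have -> : (ground M :\: G == set0) = false.
  by apply: contraNF GE; rewrite setD_eq0 eqEsubset sG.
rewrite contraction_contraction // (charpoly_empty (M := contraction M (ground M)));
  last exact: setDv.
rewrite mulr1.
rewrite -[in X in localization _ X]/(ground (contraction M G)) localization_ground.
rewrite ffunE setDUK // => /eqP; rewrite addrC addr_eq0 => /eqP <-.
apply: eq_big => F.
  rewrite fG.
  by case: (F \in flats M); case: (G \subset F); case: (F == ground M).
case/andP=> /andP[fF _] /andP[_ sGF].
by rewrite ffunE setDUK // localization_contraction // contraction_contraction.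
Qed.

End InverseKLExistence.

(* The defining conditions of each polynomial admit exactly one solution; KL and
   inverse_KL below are these solutions, and KL_spec, inverse_KL_spec are all
   that is accessible about them. *)
Lemma KL_existence : {P : matroid_invariant | is_KL P}.
Proof.
exists KL_fun; split=> T M; [exact: KL_fun_rank0 | exact: KL_fun_degree |].
exact: KL_fun_reversal.
Qed.

Lemma inverse_KL_existence : {Q : matroid_invariant | is_inverse_KL Q}.
Proof.
exists (fun T M => (-1) ^+ rk M *: sQ_fun M); split=> T M.
- by move=> r0; rewrite r0 scale1r sQ_fun_rank0.
- by move=> r0; rewrite size_scale ?signr_eq0 //; apply: sQ_fun_degree.
- rewrite reversalZ scalerA -exprD -signr_odd oddD addbb scale1r.
  rewrite sQ_fun_reversal; apply: eq_bigr => F fF.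
  rewrite rk_localization ?flat_sub // -scalerAl scalerA -exprD.
  by rewrite -signr_odd oddD addbb scale1r.
Qed.

Lemma reversal_fixed r (d : {poly int}) : (0 < r)%N -> ((size d).-1.*2 < r)%N ->
  reversal r d = d -> d = 0.
Proof.
move=> r0 sd e; apply/polyP=> i; rewrite coef0.
have [ir|ir] := leqP (size d) i; first by rewrite nth_default.
rewrite -e coef_reversal; case: leqP => // _; rewrite nth_default //.
by move: sd ir; move: (size _) => s; lia.
Qed.

Lemma KL_degreeB r (p q : {poly int}) : ((size p).-1.*2 < r)%N -> ((size q).-1.*2 < r)%N ->
   ((size (p - q)%R).-1.*2 < r)%N.
Proof.
have := size_polyD p (- q); rewrite size_polyN.
by move: (size (p - q)%R) (size p) (size q) => a b c; lia.
Qed.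

Lemma KL_uniqueness (P P' : matroid_invariant) : is_KL P -> is_KL P' ->
  forall (T : finType) (M : matroid T), P T M = P' T M.
Proof.
move=> [P0 Pd Pr] [P0' Pd' Pr'] T M.
have [m] := ubnP #|ground M|; elim: m M => // m IH M ltm.
have [r0|rpos] := posnP (rk M); first by rewrite P0 ?P0'.
have := Pr T M; have := Pr' T M.
have E : \sum_(F in flats M | F != set0) charpoly (localization M F) * P T (contraction M F)
  = \sum_(F in flats M | F != set0) charpoly (localization M F) * P' T (contraction M F).
  apply: eq_bigr => F /andP[fF F0]; rewrite IH //.
  by have := card_contraction_lt fF F0; lia.
have [f0|n0] := boolP (set0 \in flats M); last first.
  rewrite big1 => [|F fF]; last by rewrite charpoly_loops ?mul0r.
  rewrite big1 => [|F fF]; last by rewrite charpoly_loops ?mul0r.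
  move=> e' e; apply/polyP=> i.
  have H (d : {poly int}) : ((size d).-1.*2 < rk M)%N -> reversal (rk M) d = 0 -> d`_i = 0.
    move=> sd ed; have [ir|ir] := leqP (size d) i; first by rewrite nth_default.
    have := congr1 (fun q : {poly int} => q`_(rk M - i)) ed.
    rewrite /= coef_reversal leq_subr coef0 subKn //.
    by move: sd ir; move: (size _) => s; lia.
  by rewrite !H ?Pd ?Pd'.
have c1 : charpoly (localization M set0) = 1.
  by rewrite charpoly_empty ?ground_localization ?sub0set.
rewrite (bigD1 set0) //= contraction_set0 c1 mul1r => e'.
rewrite (bigD1 set0) //= contraction_set0 c1 mul1r E => e; apply/eqP; rewrite -subr_eq0; apply/eqP.
apply: (reversal_fixed rpos); first exact: KL_degreeB (Pd _ _ rpos) (Pd' _ _ rpos).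
have rN : reversal (rk M) (- P' T M) = - reversal (rk M) (P' T M).
  by rewrite -scaleN1r reversalZ scaleN1r.
rewrite reversalD rN e e'.
by rewrite opprD addrACA subrr addr0.
Qed.

Lemma inverse_KL_uniqueness (Q Q' : matroid_invariant) :
  is_inverse_KL Q -> is_inverse_KL Q' ->
  forall (T : finType) (M : matroid T), Q T M = Q' T M.
Proof.
move=> [Q0 Qd Qr] [Q0' Qd' Qr'] T M.
have [m] := ubnP #|ground M|; elim: m M => // m IH M ltm.
have [r0|rpos] := posnP (rk M); first by rewrite Q0 ?Q0'.
have c1 : reversal (rk M - rank M (ground M)) (charpoly (contraction M (ground M))) = 1.
  by rewrite charpoly_empty ?[ground _]setDv // subnn reversal01.
have E : \sum_(F in flats M | F != ground M) (-1) ^+ rank M F *: (Q T (localization M F) *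
    reversal (rk M - rank M F) (charpoly (contraction M F)))
  = \sum_(F in flats M | F != ground M) (-1) ^+ rank M F *: (Q' T (localization M F) *
    reversal (rk M - rank M F) (charpoly (contraction M F))).
  apply: eq_bigr => F /andP[fF FE]; rewrite IH //.
  by have := card_localization_lt fF FE; lia.
have := Qr T M; have := Qr' T M.
rewrite (bigD1 (ground M)) ?ground_flat //= c1 localization_ground mulr1 => e'.
rewrite (bigD1 (ground M)) ?ground_flat //= c1 localization_ground mulr1 E => e.
apply/eqP; rewrite -subr_eq0; apply/eqP.
apply: (reversal_fixed rpos); first exact: KL_degreeB (Qd _ _ rpos) (Qd' _ _ rpos).
apply: (inv_inj (signrZK (rk M))).
have rN : reversal (rk M) (- Q' T M) = - reversal (rk M) (Q' T M).
  by rewrite -scaleN1r reversalZ scaleN1r.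
rewrite reversalD rN !scalerBr e e'.
by rewrite opprD addrACA subrr addr0.
Qed.

Definition KL : matroid_invariant := sval KL_existence.

Definition inverse_KL : matroid_invariant := sval inverse_KL_existence.

Arguments KL {T} M.
Arguments inverse_KL {T} M.

Lemma KL_spec : is_KL (@KL).
Proof. exact: svalP. Qed.

Lemma inverse_KL_spec : is_inverse_KL (@inverse_KL).
Proof. exact: svalP. Qed.

Definition Zpoly (T : finType) (M : matroid T) : {poly int} :=
  \sum_(F in flats M) 'X^(rank M F) * KL (contraction M F).

(* k.-1 is only used for k > 0: for k = 0 there is no hyperplane. *)
Definition p_poly (k h : nat) : {poly int} :=
  KL (uniform k h.+1) - KL (uniform k.-1 h).

Definition q_poly (k h : nat) : {poly int} :=
  inverse_KL (uniform k h.+1) - inverse_KL (uniform k.-1 h).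

Definition z_poly (k h : nat) : {poly int} :=
  Zpoly (uniform k h.+1) - (1 + 'X) * Zpoly (uniform k.-1 h).

(* Main.v *)
Require Import Defs.
From mathcomp Require Import all_boot all_order all_algebra.
From mathcomp Require Import zify ring.
Set Implicit Arguments.
Unset Strict Implicit.
Unset Printing Implicit Defensive.
Import GRing.Theory.
Local Open Scope ring_scope.

(** Call a hyperplane of a rank k paving matroid M on E dependent if it has at least
    k elements.  A proper flat F of M is either a hyperplane, or an arbitrary set of
    at most k - 2 elements; the localizations at proper flats are uniform, the
    contraction at a small F is again paving, and its dependent hyperplanes are the
    H \ F with H dependent in M and F a subset of H.  Any k - 1 elements lie in a
    unique hyperplane, so double counting pairs (F, H) shows, by induction on the
    rank, that each of chi, P, Q, Z evaluated at M has the shape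
    a_k(#|E|) - sum over dependent hyperplanes H of g_k(#|H|), with a and g
    independent of M.  Evaluating at U_{k,n} identifies a_k(n), and evaluating at the
    direct sum of U_{k-1,h} and a coloop, whose only dependent hyperplane has h
    elements, identifies g_k(h), because adding a coloop preserves P and Q and
    multiplies Z by 1 + t. *)

(** * Paving matroids through ranks *)

Section RankPaving.
Variable T : finType.
Implicit Types (M : matroid T) (A B C F G H : {set T}).

(** Stated through ranks, the condition passes to minors by arithmetic, without tracing circuits of
    minors back to [M]. *)
Definition rank_paving M := forall A,
  A \subset ground M -> (#|A| < rk M)%N -> rank M A = #|A|.

Lemma pavingW M : paving M -> rank_paving M.
Proof.
move=> pM A sA ltA; apply/eqP; apply: contraLR ltA => nA; rewrite -leqNgt.
(* A minimal dependent subset of [A] is a circuit no larger than [A]. *)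
pose P B := (B \subset ground M) && ~~ indep M B.
have PA : P A by rewrite /P sA /indep sA.
have [C /minsetP[/andP[sC dC] minC] sCA] := minset_exists PA.
apply: leq_trans (subset_leq_card sCA); apply: pM.
rewrite /circuit sC dC; apply/forall_inP => x xC; apply: contraT => dCx.
have := minC (C :\ x); rewrite /P dCx (subset_trans _ sC) ?subD1set //.
move=> /(_ isT isT) /setP/(_ x).
by rewrite !inE eqxx xC.
Qed.

Lemma rank_le_rk M A : (rank M A <= rk M)%N.
Proof. by rewrite -rank_trace; apply/rank_mono/subsetIr. Qed.

Lemma rk_le_card M : (rk M <= #|ground M|)%N.
Proof. exact: rank_card. Qed.

(** Shrinking a large set to fewer than [rk M] elements leaves an independent set, so a large set
    has rank at least [(rk M).-1]. *)
Lemma rank_paving_ge M A : rank_paving M -> A \subset ground M ->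
  (minn #|A| (rk M).-1 <= rank M A)%N.
Proof.
move=> pM; have [m] := ubnP #|A|; elim: m A => // m IH A ltm sA.
have [lt|le] := ltnP #|A| (rk M); first by rewrite pM // geq_minl.
have [->|[x xA]] := set_0Vmem A; first by rewrite cards0 min0n.
have cA := cardsD1 x A; rewrite xA in cA.
have sub := subD1set A x.
have := IH (A :\ x); have := rank_mono M sub.
move=> h1 /(_ _ (subset_trans sub sA)) h2.
have {}h2 := h2 ltac:(lia); lia.
Qed.

Lemma flat_rankU1 M F x : flat M F -> x \in ground M -> x \notin F ->
  (rank M F < rank M (x |: F))%N.
Proof.
by case/andP=> _ /forall_inP fF xE xF; apply: fF; rewrite inE xF.
Qed.

(** With k = [rk M]: if [x] lies in one hyperplane and not in the other, their union has rank k and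
    their intersection, which contains [A], rank at least k - 1. The total 2k - 1 contradicts
    submodularity. *)
Lemma hyperplane_uniq M A H H' : hyperplane M H -> hyperplane M H' ->
  A \subset H -> A \subset H' -> ((rk M).-1 <= rank M A)%N -> H = H'.
Proof.
have sub H1 H2 : hyperplane M H1 -> hyperplane M H2 ->
  A \subset H1 -> A \subset H2 -> ((rk M).-1 <= rank M A)%N -> H1 \subset H2.
  move=> /andP[/andP[s1 _] /eqP r1] /andP[f2 /eqP r2] sA1 sA2 rA.
  apply/subsetP => x x1; apply: contraT => x2.
  have lt := flat_rankU1 f2 (subsetP s1 _ x1) x2.
  have h1 := rank_submod M H1 H2.
  have h2 : (rank M (x |: H2) <= rank M (H1 :|: H2))%N.
    by rewrite rank_mono // setSU // sub1set.
  have h3 : (rank M A <= rank M (H1 :&: H2))%N by rewrite rank_mono // subsetI sA1.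
  lia.
by move=> h h' sA sA' rA; apply/eqP; rewrite eqEsubset (sub H H') ?(sub H' H).
Qed.

Lemma hyperplane_exists M A : A \subset ground M -> ((rank M A).+1 = rk M)%N ->
  exists2 H, hyperplane M H & A \subset H.
Proof.
move=> sA rA; pose P B := (B \subset ground M) && (rank M B == rank M A).
have PA : P A by rewrite /P sA eqxx.
have [H /maxsetP[/andP[sH /eqP rH] maxH] sAH] := maxset_exists PA.
exists H => //; rewrite /hyperplane rH rA eqxx andbT /flat sH /=.
apply/forall_inP => x /setDP[xE xH]; rewrite ltn_neqAle rank_mono ?subsetUr //.
rewrite andbT; apply: contraNN xH => /eqP e.
have := maxH (x |: H); rewrite /P -e rH eqxx subUset sub1set xE sH subsetUr.
by move=> /(_ isT isT) /setP/(_ x); rewrite !inE eqxx.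
Qed.

Definition dep_hyperplanes M := [set H | hyperplane M H & (rk M <= #|H|)%N].

Lemma hyperplane_flat M H : hyperplane M H -> H \in flats M.
Proof. by rewrite inE => /andP[]. Qed.

Lemma hyperplane_sub M H : hyperplane M H -> H \subset ground M.
Proof. by move/hyperplane_flat/flat_sub. Qed.

Lemma hyperplane_rank M H : hyperplane M H -> (rank M H).+1 = rk M.
Proof. by case/andP=> _ /eqP. Qed.

(** Existence and uniqueness of the hyperplane through [A], put as a sum so that it can be inserted
    before exchanging summations. *)
Lemma sum_hyperplane_above M A (c : {poly int}) : A \subset ground M ->
  ((rank M A).+1 = rk M)%N -> \sum_(H : {set T} | hyperplane M H && (A \subset H)) c = c.
Proof.
move=> sA rA; have [H hH sAH] := hyperplane_exists sA rA.
rewrite (big_pred1 H) // => H' /=; apply/andP/eqP => [[hH' sA'] | ->] //.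
by apply: (@hyperplane_uniq M A) => //; rewrite -rA.
Qed.

Lemma sum_dep_hyperplane_above M A (c : {poly int}) :
  A \subset ground M -> (rk M <= #|A|)%N -> ((rank M A).+1 = rk M)%N ->
  \sum_(H in dep_hyperplanes M | A \subset H) c = c.
Proof.
move=> sA cA rA; rewrite -[RHS](sum_hyperplane_above c sA rA).
apply: eq_bigl => H; rewrite inE -andbA; congr (_ && _).
by case: (boolP (A \subset H)) => s; rewrite ?andbF // andbT (leq_trans cA) ?subset_leq_card.
Qed.

Lemma small_flat M A : rank_paving M -> A \subset ground M -> (#|A|.+1 < rk M)%N ->
  A \in flats M.
Proof.
move=> pM sA ltA; rewrite inE /flat sA /=; apply/forall_inP => x /setDP[xE xA].
have c : #|x |: A| = #|A|.+1 by rewrite cardsU1 xA.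
by rewrite !pM ?c ?subUset ?sub1set ?xE //; lia.
Qed.

(** A flat other than the ground set has rank below k = [rk M]; if that rank is not k - 1, then
    [rank_paving_ge] bounds its size by its rank, hence by k - 2. *)
Lemma sum_flats_paving M (phi : {set T} -> {poly int}) :
  rank_paving M -> (0 < rk M)%N ->
  \sum_(F in flats M) phi F =
  \sum_(F : {set T} | (F \subset ground M) && (#|F|.+1 < rk M)%N) phi F +
  \sum_(H : {set T} | hyperplane M H) phi H + phi (ground M).
Proof.
move=> pM k0; rewrite (bigD1 (ground M)) ?ground_flat //= addrC; congr (_ + _).
rewrite (bigID (hyperplane M)) /= addrC; congr (_ + _); apply: eq_bigl => F.
  apply/andP/andP => [[/andP[fF ne] nh] | [sF lt]].
    have sF := flat_sub fF; split=> //.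
    have := rank_flat_lt fF ne; have := rank_paving_ge pM sF.
    by move: nh; rewrite /hyperplane; move: fF; rewrite inE => -> /=; lia.
  have fF := small_flat pM sF lt; have rF := pM F sF ltac:(lia).
  rewrite fF /hyperplane rF; split; last by rewrite negb_and; apply/orP; right; lia.
  by apply: contraTneq lt => ->; have := rk_le_card M; lia.
apply/andP/idP => [[]//|hF]; split=> //; rewrite hyperplane_flat //=.
by apply/eqP => e; have := hyperplane_rank hF; rewrite e /rk; lia.
Qed.

Lemma sum_subsets_of_size B i (c : {poly int}) :
  \sum_(A : {set T} | (A \subset B) && (#|A| == i)) c = c *+ 'C(#|B|, i).
Proof.
by rewrite -cards_draws -sumr_const; apply: eq_bigl => A; rewrite inE.
Qed.

Lemma rank_paving_contraction M F : rank_paving M -> F \subset ground M ->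
  (#|F| < rk M)%N -> rank_paving (contraction M F).
Proof.
move=> pM sF ltF A; rewrite subsetD => /andP[sA dA].
have cAF : #|A :|: F| = (#|A| + #|F|)%N.
  by rewrite cardsU (disjoint_setI0 dA) cards0 subn0.
have rF := pM F sF ltF.
rewrite rk_contraction // rank_contraction => lt.
by rewrite !pM ?cAF ?subUset ?sA ?sF //; lia.
Qed.

Lemma hyperplane_contraction M F H : F \in flats M -> [disjoint H & F] ->
  hyperplane (contraction M F) H = hyperplane M (H :|: F).
Proof.
move=> fF d; have sF := flat_sub fF.
have := flats_contraction_in sF d; rewrite /hyperplane !inE => ->.
congr (_ && _); rewrite rk_contraction // rank_contraction.
have := rank_mono M (subsetUr H F); have := rank_le_rk M (H :|: F).
by move=> h1 h2; apply/eqP/eqP; lia.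
Qed.

(** The bijection is [H] to [H :\: F]. As [rank M F = #|F|], sizes and the rank threshold drop by
    the same amount, so dependence is preserved both ways. *)
Lemma sum_dep_hyperplanes_contraction M F (g : nat -> {poly int}) :
  F \in flats M -> rank M F = #|F| ->
  \sum_(H in dep_hyperplanes (contraction M F)) g #|H| =
  \sum_(H in dep_hyperplanes M | F \subset H) g (#|H| - #|F|)%N.
Proof.
move=> fF rF; have sF := flat_sub fF.
have dF H : [disjoint H :\: F & F].
  by rewrite disjoints_subset; apply/subsetP => x; rewrite !inE => /andP[].
rewrite (reindex_onto (fun H => H :\: F) (fun H => H :|: F)) /=; last first.
  move=> H; rewrite inE => /andP[/hyperplane_sub/=].
  by rewrite subsetD => /andP[_ /setDidPl]; rewrite setDUl setDv setU0.
apply: eq_big => [H|H /andP[_ /eqP e]]; last first.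
  by rewrite cardsD (setIidPr _) // -e subsetUr.
rewrite !inE; have [s|s] := boolP (F \subset H); last first.
  by rewrite andbF; apply: contraNF s => /andP[_ /eqP <-]; rewrite subsetUr.
rewrite setDUK // eqxx !andbT hyperplane_contraction // setDUK //.
rewrite rk_contraction // cardsD (setIidPr s) rF.
have := subset_leq_card s; have := rank_le_rk M F; rewrite rF => h1 h2.
by congr (_ && _); apply/idP/idP; lia.
Qed.

Lemma rank_paving_localization M F : rank_paving M -> F \subset ground M ->
  rank_paving (localization M F).
Proof.
move=> pM sF A; rewrite ground_localization // rk_localization // => sA lt.
rewrite rank_localization // pM ?(subset_trans sA) //.
exact: leq_trans lt (rank_le_rk _ _).
Qed.

(** A hyperplane of the localization has rank at most [rk M] - 2 in [M], so by [rank_paving_ge] its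
    size is at most its rank, below the threshold [rank M F]. *)
Lemma dep_hyperplanes_localization M F : rank_paving M -> F \subset ground M ->
  (rank M F < rk M)%N -> dep_hyperplanes (localization M F) = set0.
Proof.
move=> pM sF ltF; apply/setP => H; rewrite !inE; apply/andP => -[hH].
have sH := hyperplane_sub hH; have := hyperplane_rank hH; move: sH.
rewrite ground_localization // rk_localization // => sH.
rewrite rank_localization // => r1 r2.
have := rank_paving_ge pM (subset_trans sH sF); lia.
Qed.

End RankPaving.

(** * Invariants additive over dependent hyperplanes *)

(* The functions [a] and [g] are left unspecified: [hyp_additive_formula] recovers
   them by evaluating [f] on two families of test matroids. *)
Definition hyp_additive (k : nat) (f : matroid_invariant) :=
  exists a g : nat -> {poly int}, forall (T : finType) (M : matroid T),
    rank_paving M -> rk M = k ->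
    f T M = a #|ground M| - \sum_(H in dep_hyperplanes M) g #|H|.

Lemma hyp_additive_ext k (f f' : matroid_invariant) :
  (forall (T : finType) (M : matroid T), rank_paving M -> rk M = k ->
     f' T M = f T M) ->
  hyp_additive k f -> hyp_additive k f'.
Proof. by move=> e [a [g fE]]; exists a, g => T M pM kM; rewrite e ?fE. Qed.

Lemma hyp_additive_card k (a : nat -> {poly int}) :
  hyp_additive k (fun T M => a #|ground M|).
Proof. by exists a, (fun=> 0) => T M _ _; rewrite big1 ?subr0. Qed.

Lemma hyp_additiveD k (f f' : matroid_invariant) :
  hyp_additive k f -> hyp_additive k f' ->
  hyp_additive k (fun T M => f T M + f' T M).
Proof.
move=> [a [g fE]] [a' [g' fE']].
exists (fun n => a n + a' n), (fun h => g h + g' h) => T M pM kM.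
by rewrite fE ?fE' // big_split opprD addrACA.
Qed.

(** Covers multiplication by a fixed polynomial, reversal, sign changes and truncation, the
    operations occurring in the recursions. *)
Lemma hyp_additive_morph k (phi : {poly int} -> {poly int})
    (f : matroid_invariant) :
  {morph phi : x y / x + y} -> hyp_additive k f ->
  hyp_additive k (fun T M => phi (f T M)).
Proof.
move=> phiD [a [g fE]]; exists (phi \o a), (phi \o g) => T M pM kM /=.
have phi0 : phi 0 = 0 by apply: (addIr (phi 0)); rewrite -phiD !add0r.
rewrite fE // -(big_morph phi phiD phi0); set s := \sum_(_ in _) _.
by apply: (addIr (phi s)); rewrite -phiD !subrK.
Qed.

(** Double counting of pairs [F], [H] with [F] inside [H]: the ground set has C(n, i) subsets of
    size i, and a hyperplane of size h has C(h, i). The bound on [i] makes each [F] an independent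
    flat. *)
Lemma hyp_additive_contractions k i (f : matroid_invariant) : (i.+1 < k)%N ->
  hyp_additive (k - i) f ->
  hyp_additive k (fun T M =>
    \sum_(F : {set T} | (F \subset ground M) && (#|F| == i))
       f T (contraction M F)).
Proof.
move=> ltik [a [g fE]].
exists (fun n => a (n - i)%N *+ 'C(n, i)), (fun h => g (h - i)%N *+ 'C(h, i)).
move=> T M pM kM.
transitivity (\sum_(F : {set T} | (F \subset ground M) && (#|F| == i))
  (a (#|ground M| - i)%N -
   \sum_(H in dep_hyperplanes M | F \subset H) g (#|H| - i)%N)).
  apply: eq_bigr => F /andP[sF /eqP cF].
  have fF : F \in flats M by apply: small_flat; rewrite ?kM ?cF.
  have rF : rank M F = #|F| by apply: pM; rewrite ?kM ?cF // ltnW.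
  rewrite fE; first last.
  - by rewrite rk_contraction // kM rF cF.
  - by apply: rank_paving_contraction; rewrite ?kM ?cF // ltnW.
  by rewrite sum_dep_hyperplanes_contraction //= cardsD (setIidPr sF) cF.
rewrite sumrB sum_subsets_of_size; congr (_ - _).
rewrite (exchange_big_dep (mem (dep_hyperplanes M))) /=; last by move=> ? ? _ /andP[].
apply: eq_bigr => H dH; rewrite -sum_subsets_of_size; apply: eq_bigl => F.
have sH : H \subset ground M by move: dH; rewrite inE => /andP[/hyperplane_sub].
rewrite dH /=.
case: (boolP (F \subset H)) => s; last by rewrite !andbF.
by rewrite (subset_trans s sH) !andbT.
Qed.

(** Induction on [m], splitting off the sets of size [m]. The lower bound [s] allows the empty set
    to be excluded, since its contraction is [M] itself. *)
Lemma hyp_additive_contractions_range k s m (f : nat -> matroid_invariant) :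
  (m < k)%N -> (forall i, (s <= i < m)%N -> hyp_additive (k - i) (f i)) ->
  hyp_additive k (fun T M =>
    \sum_(F : {set T} | (F \subset ground M) && (s <= #|F| < m)%N)
       f #|F| T (contraction M F)).
Proof.
elim: m => [|m IH] ltk fA.
  apply: (hyp_additive_ext _ (hyp_additive_card k (fun=> 0))) => T M _ _.
  by rewrite big_pred0 // => F; lia.
have [les|lts] := leqP s m; last first.
  apply: (hyp_additive_ext _ (hyp_additive_card k (fun=> 0))) => T M _ _.
  by rewrite big_pred0 // => F; lia.
have IH' := IH (ltnW ltk) (fun i lt => fA i ltac:(lia)).
have Cm := hyp_additive_contractions ltk (fA m ltac:(lia)).
apply: hyp_additive_ext (hyp_additiveD IH' Cm) => T M _ _ /=.
rewrite (bigID (fun F : {set T} => #|F| == m)) /= addrC; congr (_ + _).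
  by apply: eq_bigl => F; rewrite -andbA; congr (_ && _); lia.
transitivity (\sum_(F : {set T} | (F \subset ground M) && (#|F| == m))
    f #|F| T (contraction M F)).
  by apply: eq_bigl => F; rewrite -andbA; congr (_ && _); lia.
by apply: eq_bigr => F /andP[_ /eqP ->].
Qed.

(** Each set of k - 1 elements lies in exactly one hyperplane, so C(n, k - 1) is the sum of C(#|H|,
    k - 1) over all hyperplanes. This trades the hyperplanes of size k - 1 for the dependent
    ones. *)
Lemma hyp_additive_hyperplanes k (psi : nat -> {poly int}) : (0 < k)%N ->
  hyp_additive k (fun T M => \sum_(H : {set T} | hyperplane M H) psi #|H|).
Proof.
move=> k0; exists (fun n => psi k.-1 *+ 'C(n, k.-1)).
exists (fun h => psi k.-1 *+ 'C(h, k.-1) - psi h) => T M pM kM.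
have -> : psi k.-1 *+ 'C(#|ground M|, k.-1) =
    \sum_(H : {set T} | hyperplane M H) psi k.-1 *+ 'C(#|H|, k.-1).
  transitivity (\sum_(A : {set T} | (A \subset ground M) && (#|A| == k.-1))
     \sum_(H : {set T} | hyperplane M H && (A \subset H)) psi k.-1).
    rewrite -sum_subsets_of_size; apply: eq_bigr => A /andP[sA /eqP cA].
    rewrite sum_hyperplane_above // pM // cA kM; lia.
  rewrite (exchange_big_dep (hyperplane M)) /=; last by move=> ? ? _ /andP[].
  apply: eq_bigr => H hH; rewrite -sum_subsets_of_size; apply: eq_bigl => A.
  rewrite hH /=; case: (boolP (A \subset H)) => s; last by rewrite !andbF.
  by rewrite (subset_trans s) ?hyperplane_sub // andbT.
have DE (F : {set T} -> {poly int}) : \sum_(H in dep_hyperplanes M) F H =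
    \sum_(H : {set T} | hyperplane M H && (k <= #|H|)%N) F H.
  by apply: eq_bigl => H; rewrite inE kM.
rewrite sumrB !DE (bigID (fun H : {set T} => k <= #|H|)%N) /=.
rewrite [X in _ = X - _](bigID (fun H : {set T} => k <= #|H|)%N) /=.
suff -> : \sum_(H : {set T} | hyperplane M H && ~~ (k <= #|H|)%N) psi #|H| =
   \sum_(H : {set T} | hyperplane M H && ~~ (k <= #|H|)%N)
      psi k.-1 *+ 'C(#|H|, k.-1) by ring.
(* The remaining hyperplanes have exactly k - 1 elements, where the binomial coefficient is 1. *)
apply: eq_bigr => H /andP[hH ltH].
have := rank_card M H; have := hyperplane_rank hH; rewrite kM => h1 h2.
have -> : #|H| = k.-1 by lia.
by rewrite binn.
Qed.

(** * Additivity of the characteristic polynomial *)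

Lemma sum_by_card (T : finType) (E : {set T}) (c : nat -> {poly int}) :
  \sum_(A : {set T} | A \subset E) c #|A| =
  \sum_(i < #|E|.+1) c i *+ 'C(#|E|, i).
Proof.
rewrite (partition_big (fun A : {set T} => inord #|A| : 'I_#|E|.+1) xpredT) //=.
apply: eq_bigr => i _; rewrite -sum_subsets_of_size.
have eqi (A : {set T}) : A \subset E -> (inord #|A| == i) = (#|A| == i).
  move=> sA; rewrite -val_eqE /= inordK // ltnS; exact: subset_leq_card.
rewrite (eq_bigl (fun A : {set T} => (A \subset E) && (#|A| == i))) => [|A].
  by apply: eq_bigr => A /andP[_ /eqP ->].
by case: (boolP (A \subset E)) => //= /eqi.
Qed.

Lemma hyp_additive_charpoly k : hyp_additive k charpoly.
Proof.
(* Truncated subtraction makes ['X^(k - i)] equal to 1 for i at least k, as if such sets had full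
   rank. A set of rank k - 1 really contributes ['X]; [b] is the correction, charged to the unique
   hyperplane containing the set. *)
pose b i : {poly int} := if (k <= i)%N then (-1) ^+ i *: ('X - 1) else 0.
exists (fun n => \sum_(i < n.+1) ((-1) ^+ i *: 'X^(k - i)) *+ 'C(n, i)).
exists (fun h => - \sum_(i < h.+1) b i *+ 'C(h, i)) => T M pM kM.
rewrite sumrN opprK -(@sum_by_card T _ (fun i => (-1) ^+ i *: 'X^(k - i))).
under [X in _ = _ + X]eq_bigr do rewrite -sum_by_card.
rewrite (exchange_big_dep (fun A : {set T} => A \subset ground M)) /=; last first.
  move=> H A; rewrite inE => /andP[/hyperplane_sub sH _] sA; exact: subset_trans sH.
rewrite /charpoly kM -big_split /=; apply: eq_bigr => A sA.
rewrite /b; case: leqP => cA; last by rewrite big1 // addr0 pM // kM.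
have -> : (k - #|A| = 0)%N by lia.
have := rank_le_rk M A; rewrite kM leq_eqVlt => /predU1P[rA | ltA].
  rewrite rA subnn big_pred0 ?addr0 // => H; apply/andP => -[].
  rewrite inE => /andP[hH _] sAH; have := rank_mono M sAH.
  have := hyperplane_rank hH; lia.
have rA : (rank M A).+1 = k by have := rank_paving_ge pM sA; lia.
rewrite sum_dep_hyperplane_above ?kM // -scalerDr; congr (_ *: _).
by rewrite -rA subSnn expr0 expr1; ring.
Qed.

(** * Uniform matroids and localizations of paving matroids *)

Lemma rank_uniform k n (A : {set 'I_n}) : rank (uniform k n) A = minn #|A| k.
Proof. by rewrite ffunE. Qed.

Lemma rk_uniform k n : (k <= n)%N -> rk (uniform k n) = k.
Proof. by move=> le; rewrite /rk rank_uniform cardsT card_ord; apply/minn_idPr. Qed.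

Lemma rank_paving_uniform k n : (k <= n)%N -> rank_paving (uniform k n).
Proof.
move=> le A _; rewrite rk_uniform // rank_uniform => lt; apply/minn_idPl; lia.
Qed.

Lemma dep_hyperplanes_uniform k n : (k <= n)%N ->
  dep_hyperplanes (uniform k n) = set0.
Proof.
move=> le; apply/setP => H; rewrite !inE; apply/andP => -[/hyperplane_rank].
rewrite rank_uniform rk_uniform //; lia.
Qed.

(** Both sides equal the same [a] at [#|ground M|], so no isomorphism with the uniform matroid has
    to be built, although the ambient types differ. *)
Lemma hyp_additive_uniform k (f : matroid_invariant) (T : finType)
    (M : matroid T) :
  hyp_additive k f -> rank_paving M -> rk M = k -> dep_hyperplanes M = set0 ->
  f T M = f _ (uniform k #|ground M|).
Proof.
move=> [a [g fE]] pM kM D0; have le := rk_le_card M; rewrite kM in le.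
rewrite !fE ?rk_uniform ?dep_hyperplanes_uniform ?D0 ?big_set0 //.
  by rewrite cardsT card_ord.
exact: rank_paving_uniform.
Qed.

Lemma hyp_additive_localization k (f : matroid_invariant) (T : finType)
    (M : matroid T) (F : {set T}) :
  hyp_additive k f -> rank_paving M -> F \subset ground M -> rank M F = k ->
  (k < rk M)%N -> f T (localization M F) = f _ (uniform k #|F|).
Proof.
move=> fA pM sF rF lt.
rewrite (hyp_additive_uniform fA) ?ground_localization ?rk_localization //.
  exact: rank_paving_localization.
by apply: dep_hyperplanes_localization; rewrite ?rF.
Qed.

(* The degree bound separates the supports of [p] and of its reversal, so that the
   defining recursions express P and Q as additive images of their right-hand sides. *)
Lemma low_degree_part k (p : {poly int}) : (0 < k)%N -> ((size p).-1.*2 < k)%N ->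
  p = - take_poly (uphalf k) (reversal k p - p).
Proof.
move=> k0 sp; apply/polyP => i; rewrite coefN coef_take_poly coefB coef_reversal.
case: ltnP => ik; last by rewrite oppr0 nth_default //; move: (size _) sp => s; lia.
have -> : (i <= k)%N by lia.
by rewrite [p`_(k - i)]nth_default ?sub0r ?opprK //; move: (size _) sp => s; lia.
Qed.

Lemma size_KL_invariant (P : matroid_invariant) (T : finType) (M : matroid T) :
  KL_rank0 P -> KL_degree P -> (size (P T M) <= (rk M).+1)%N.
Proof.
move=> P0 Pd; have [r0|r0] := posnP (rk M); last by have := Pd T M r0; lia.
by rewrite P0 //; case: ifP => _; rewrite ?size_poly1 ?size_poly0.
Qed.

Lemma KL_rank0_additive (P : matroid_invariant) : KL_rank0 P -> hyp_additive 0 P.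
Proof.
move=> P0; apply: (hyp_additive_ext _ (hyp_additive_card 0 (fun n => (n == 0%N)%:R))).
by move=> T M _ /P0->; rewrite cards_eq0; case: eqP.
Qed.

(** * Matroids of rank one *)

Section RankOne.
Variable T : finType.
Implicit Type M : matroid T.

Lemma sum_flats_rank1 M (phi : {set T} -> {poly int}) : rk M = 1%N ->
  set0 \in flats M -> \sum_(F in flats M) phi F = phi set0 + phi (ground M).
Proof.
move=> k1 f0; have ne : ground M != set0.
  by apply/eqP => e; move: k1; rewrite /rk e rank_set0.
rewrite (bigD1 set0) //= (big_pred1 (ground M)) // => F /=.
apply/andP/eqP => [[fF F0] | ->]; last by rewrite ground_flat.
apply/eqP; apply: contraNT F0 => FE; have := rank_flat_lt fF FE.
rewrite k1 ltnS leqn0 => /eqP rF; apply/set0Pn => -[x xF].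
move: f0; rewrite inE => /flat_rankU1 /(_ (subsetP (flat_sub fF) _ xF)).
rewrite inE rank_set0 setU0 => /(_ isT); have : [set x] \subset F by rewrite sub1set.
move/(rank_mono M); lia.
Qed.

Lemma charpoly_rank1 M : rk M = 1%N -> set0 \in flats M -> charpoly M = 'X - 1.
Proof.
move=> k1 f0; have := sum_charpoly_contraction (sub0set (ground M)).
rewrite (eq_bigl (mem (flats M))) => [|F]; last by rewrite sub0set andbT.
rewrite sum_flats_rank1 // contraction_set0 rank_set0 k1 subn0 expr1 => <-.
by rewrite [charpoly (contraction _ _)]charpoly_empty ?addrK //= setDv.
Qed.

Lemma KL_ground M : KL (contraction M (ground M)) = 1.
Proof.
have [K0 _ _] := KL_spec.
by rewrite K0 ?rk_contraction ?subnn //= setDv eqxx.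
Qed.

Lemma KL_loops M : set0 \notin flats M -> KL M = 0.
Proof.
have [K0 Kd Kr] := KL_spec; move=> n0.
(* With loops every localization at a flat has zero characteristic polynomial, so the reversal of
   [KL M] vanishes. *)
rewrite -(reversalK (size_KL_invariant M K0 Kd)) Kr big1 ?reversal0 //.
by move=> F fF; rewrite charpoly_loops ?mul0r.
Qed.

Lemma KL_rank1 M : rk M = 1%N -> KL M = (set0 \in flats M)%:R.
Proof.
move=> k1; have [f0|n0] := boolP (set0 \in flats M); last by rewrite KL_loops.
have [_ Kd Kr] := KL_spec; have := Kd T M; rewrite k1 => /(_ isT) sK.
rewrite (low_degree_part _ sK) // -k1 Kr sum_flats_rank1 // contraction_set0.
rewrite charpoly_empty ?ground_localization ?sub0set // mul1r localization_ground.
rewrite KL_ground mulr1 charpoly_rank1 // addrAC subrr add0r k1.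
by apply/polyP => i; rewrite coefN coef_take_poly coefB coefX !coef1; case: i.
Qed.

Lemma contraction_hyperplane M H : hyperplane M H ->
  rk (contraction M H) = 1%N /\ set0 \in flats (contraction M H).
Proof.
move=> hH; have sH := hyperplane_sub hH; split.
  by rewrite rk_contraction // -(hyperplane_rank hH) subSnn.
by rewrite flats_contraction_in ?set0U ?hyperplane_flat // disjoints_subset sub0set.
Qed.

Lemma KL_hyperplane M H : hyperplane M H -> KL (contraction M H) = 1.
Proof. by case/contraction_hyperplane => k1 f0; rewrite KL_rank1 ?f0. Qed.

End RankOne.

(** * Additivity of P, Z and Q *)

Lemma hyp_additive_KL k : hyp_additive k (@KL).
Proof.
have [K0 Kd Kr] := KL_spec.
elim/ltn_ind: k => -[|[|k]] IH; first exact: KL_rank0_additive.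
  (* Rank 1 is separate because loops are possible: the empty set need not be a flat, and when it
     is, it is a hyperplane. So P counts the empty hyperplanes. *)
  apply: hyp_additive_ext (hyp_additive_hyperplanes (fun h => (h == 0%N)%:R) (ltn0Sn 0)).
  move=> T M _ k1; rewrite KL_rank1 //.
  have h0 : hyperplane M set0 = (set0 \in flats M).
    by rewrite /hyperplane rank_set0 k1 andbT inE.
  have [f0|n0] := boolP (set0 \in flats M).
    rewrite (bigD1 set0) ?h0 //= cards0 big1 ?addr0 // => H /andP[_].
    by rewrite -cards_eq0 => /negPf ->.
  rewrite big1 // => H hH; rewrite cards_eq0; case: eqP => // e.
  by move: hH n0; rewrite e h0 => ->.
set m := k.+2 in IH *; have m0 : (0 < m)%N by [].
(* The localization at an independent flat of size i has the characteristic polynomial of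
   [uniform i i]. The range starts at 1 so that the induction hypothesis applies to the
   contractions. *)
pose f i : matroid_invariant := fun T M => charpoly (uniform i i) * KL M.
have fA i : (1 <= i < m.-1)%N -> hyp_additive (m - i) (f i).
  move=> lti; apply: hyp_additive_morph (IH (m - i)%N ltac:(lia)).
  by move=> x y; rewrite mulrDr.
have FA := hyp_additive_contractions_range (ltnSn m.-1 : (m.-1 < m)%N) fA.
have HA := hyp_additive_hyperplanes (fun h => charpoly (uniform m.-1 h)) m0.
have S := hyp_additiveD (hyp_additiveD FA HA) (hyp_additive_charpoly m).
have tA := hyp_additive_morph (fun x y => raddfD (take_poly (uphalf m)) x y) S.
apply: hyp_additive_ext (hyp_additive_morph (@opprD _) tA) => T M pM kM.
have sK := Kd T M; rewrite kM in sK.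
rewrite {1}(low_degree_part m0 (sK m0)); congr (- take_poly _ _).
apply: (addIr (KL M)); rewrite subrK -kM Kr sum_flats_paving // ?kM //.
have f0 : set0 \in flats M by apply: small_flat; rewrite ?sub0set ?cards0 ?kM.
rewrite localization_ground KL_ground mulr1.
rewrite (bigD1 set0) /=; last by rewrite sub0set cards0.
rewrite contraction_set0 charpoly_empty ?ground_localization ?sub0set // mul1r.
rewrite [RHS]addrC -!addrA; congr (_ + (_ + (_ + _))).
  apply: eq_big => F; first by rewrite -card_gt0 -andbA; congr (_ && _); lia.
  move=> /andP[/andP[sF ltF] _]; rewrite /f; congr (_ * _).
  apply: (hyp_additive_localization (hyp_additive_charpoly _)) => //.
    by apply: pM; lia.
  lia.
apply: eq_bigr => H hH; have rH := hyperplane_rank hH; rewrite kM in rH.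
rewrite KL_hyperplane // mulr1.
apply: (hyp_additive_localization (hyp_additive_charpoly _)) => //.
- exact: hyperplane_sub.
- by move: rH => /= [].
- by rewrite kM.
Qed.

Lemma hyp_additive_Zpoly k : hyp_additive k Zpoly.
Proof.
case: k => [|k].
  apply: hyp_additive_ext (hyp_additive_card 0 (fun=> 1)) => T M _ k0.
  rewrite /Zpoly (big_pred1 (ground M)) => [|F /=].
    by rewrite KL_ground mulr1 -/(rk M) k0.
  apply/idP/eqP => [fF|->]; last exact: ground_flat.
  by apply/eqP; apply: contraT => /(rank_flat_lt fF); rewrite k0.
pose f i : matroid_invariant := fun T M => 'X^i * KL M.
have fA i : (0 <= i < k)%N -> hyp_additive (k.+1 - i) (f i).
  move=> _; apply: hyp_additive_morph (hyp_additive_KL _) => x y.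
  by rewrite mulrDr.
have FA := hyp_additive_contractions_range (ltnSn k) fA.
have HA := hyp_additive_hyperplanes (fun=> 'X^k) (ltn0Sn k).
have CA := hyp_additive_card k.+1 (fun=> 'X^(k.+1)).
apply: hyp_additive_ext (hyp_additiveD (hyp_additiveD FA HA) CA) => T M pM kM.
rewrite /Zpoly sum_flats_paving ?kM // KL_ground mulr1 -/(rk M) kM.
congr (_ + _ + _).
  by apply: eq_bigr => F /andP[sF ltF]; rewrite /f pM ?kM // ltnW.
apply: eq_bigr => H hH; rewrite KL_hyperplane // mulr1.
by have := hyperplane_rank hH; rewrite kM => -[->].
Qed.

Lemma hyp_additive_inverse_KL k : hyp_additive k (@inverse_KL).
Proof.
have [K0 Kd Kr] := inverse_KL_spec.
elim/ltn_ind: k => -[|k] IH; first exact: KL_rank0_additive.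
have m0 := ltn0Sn k.
(* Here the unknown Q is the term of the ground set. At proper flats Q is taken of localizations,
   which the induction hypothesis replaces by uniform matroids; the contractions enter only through
   [charpoly], so the range may start at 0. *)
pose f i : matroid_invariant := fun T M => (-1) ^+ i *:
  (inverse_KL (uniform i i) * reversal (k.+1 - i) (charpoly M)).
have fA i : (0 <= i < k)%N -> hyp_additive (k.+1 - i) (f i).
  move=> _; apply: (hyp_additive_morph (phi := fun p => (-1) ^+ i *:
    (inverse_KL (uniform i i) * reversal (k.+1 - i) p))) => [x y|].
    by rewrite reversalD mulrDr scalerDr.
  exact: hyp_additive_charpoly.
have FA := hyp_additive_contractions_range (ltnSn k) fA.
(* The rank is [k.+1], so hyperplanes have rank [k]; contracting one leaves a loopless matroid of
   rank 1, whence ['X - 1]. *)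
pose psi h : {poly int} :=
  (-1) ^+ k *: (inverse_KL (uniform k h) * reversal 1 ('X - 1)).
have S := hyp_additiveD FA (hyp_additive_hyperplanes psi m0).
pose phi (p : {poly int}) := - take_poly (uphalf k.+1) ((-1) ^+ k.+1 *: p).
have phiD : {morph phi : x y / x + y}.
  by move=> x y; rewrite /phi scalerDr raddfD opprD.
apply: hyp_additive_ext (hyp_additive_morph phiD S) => T M pM kM.
have sK := Kd T M; rewrite kM in sK.
rewrite {1}(low_degree_part m0 (sK m0)); congr (- take_poly _ _).
apply: (can_inj (signrZK k.+1)); rewrite signrZK scalerBr.
have := Kr T M; rewrite kM => ->.
rewrite sum_flats_paving ?kM // localization_ground -/(rk M) kM subnn.
rewrite [charpoly (contraction _ _)]charpoly_empty ?[ground _]setDv //.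
rewrite reversal01 mulr1 addrK; congr (_ + _).
  apply: eq_bigr => F /andP[sF ltF]; have rF : rank M F = #|F| by apply: pM; lia.
  rewrite /f rF; congr (_ *: (_ * _)).
  apply: (hyp_additive_localization (IH _ _)) => //; lia.
apply: eq_bigr => H hH; have := hyperplane_rank hH; rewrite kM => -[rH].
have [k1 f0] := contraction_hyperplane hH.
rewrite /psi rH subSnn charpoly_rank1 //; congr (_ *: (_ * _)).
by apply: (hyp_additive_localization (IH _ _)); rewrite ?kM ?hyperplane_sub.
Qed.

(** * Coloops *)

Section Coloop.
Variable T : finType.
Implicit Types (M : matroid T) (A B F G : {set T}) (e : T).

Definition coloop M e := e \in ground M /\
  forall A, e \notin A -> rank M (e |: A) = (rank M A).+1.

Definition deletion M e := localization M (ground M :\ e).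

Lemma sum_subsets_split e (P : pred {set T}) (phi : {set T} -> {poly int}) :
  \sum_(A | P A) phi A = \sum_(A : {set T} | P A && (e \notin A)) phi A +
                         \sum_(A : {set T} | P (e |: A) && (e \notin A)) phi (e |: A).
Proof.
rewrite (bigID (fun A : {set T} => e \notin A)) /=; congr (_ + _).
rewrite (reindex_onto (fun A => e |: A) (fun A => A :\ e)) /= => [|A]; last first.
  by rewrite negbK => /andP[_ /setD1K].
apply: eq_bigl => A; rewrite setU11 andbT; congr (_ && _).
apply/eqP/idP => [<-|nA]; [by rewrite setD11 | exact: setU1K].
Qed.

Lemma ground_deletion M e : ground (deletion M e) = ground M :\ e.
Proof. by rewrite ground_localization ?subD1set. Qed.

Lemma rank_deletion M e A : A \subset ground M :\ e ->
  rank (deletion M e) A = rank M A.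
Proof. exact: rank_localization. Qed.

Lemma rk_deletion M e : coloop M e -> rk M = (rk (deletion M e)).+1.
Proof.
case=> eE cl; rewrite rk_localization ?subD1set // -cl ?setD1K //.
by rewrite !inE eqxx.
Qed.

(** Adding a coloop raises the rank, so its complement is a flat and the deletion is a localization
    at a flat. *)
Lemma flats_deletion M e : coloop M e ->
  flats (deletion M e) = [set G in flats M | e \notin G].
Proof.
move=> [eE cl]; rewrite flats_localization; last first.
  rewrite inE /flat subD1set /=; apply/forall_inP => x.
  rewrite !inE negb_and negbK => /andP[/orP[/eqP->|/negPf->]//].
  by rewrite cl ?ltnSn // !inE eqxx.
apply/setP => G; rewrite !inE subsetD1.
by case: (boolP (flat M G)) => //= /andP[->].
Qed.

Lemma flatU1_coloop M e G : coloop M e -> e \notin G ->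
  (e |: G \in flats M) = (G \in flats M).
Proof.
move=> [eE cl] nG; rewrite !inE /flat subUset sub1set eE /=; congr (_ && _).
apply/forall_inP/forall_inP => fG x; rewrite !inE.
  case/andP=> xG xE; have [->|ne] := eqVneq x e; first by rewrite cl.
  have := fG x; rewrite !inE negb_or ne xG xE => /(_ isT).
  by rewrite setUCA !cl // !inE negb_or eq_sym ne.
rewrite negb_or => /andP[/andP[ne xG] xE]; have := fG x.
by rewrite !inE xG xE setUCA !cl // ?ltnS; [apply | rewrite !inE negb_or eq_sym ne].
Qed.

(** The lattice of flats is that of the deletion times a two-element chain. *)
Lemma sum_flats_coloop M e (phi : {set T} -> {poly int}) : coloop M e ->
  \sum_(F in flats M) phi F =
  \sum_(G in flats (deletion M e)) (phi G + phi (e |: G)).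
Proof.
move=> cl; rewrite (sum_subsets_split e) big_split flats_deletion //=.
congr (_ + _); apply: eq_bigl => G; first by rewrite [RHS]inE.
rewrite [RHS]inE; case: (boolP (e \in G)) => eG; first by rewrite !andbF.
by rewrite !andbT flatU1_coloop.
Qed.

Lemma flat_deletion_sub M e G : G \in flats (deletion M e) ->
  G \subset ground M :\ e.
Proof. by move/flat_sub; rewrite ground_deletion. Qed.

Lemma coloop_contraction M e G : coloop M e -> G \subset ground M :\ e ->
  coloop (contraction M G) e.
Proof.
move=> [eE cl]; rewrite subsetD1 => /andP[sG eG]; split; first by rewrite inE eG.
move=> A eA; rewrite !rank_contraction -setUA cl; last first.
  by rewrite inE negb_or eA.
by rewrite subSn // rank_mono ?subsetUr.
Qed.

Lemma deletion_contraction M e G : G \subset ground M :\ e ->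
  deletion (contraction M G) e = contraction (deletion M e) G.
Proof.
move=> sG; rewrite -localization_contraction //; congr (localization _ _).
by rewrite /= setDDl setUC -setDDl.
Qed.

(** Contracting a coloop amounts to deleting it. *)
Lemma contractionU1_coloop M e G : coloop M e -> G \subset ground M :\ e ->
  contraction M (e |: G) = contraction (deletion M e) G.
Proof.
move=> [eE cl] sG; have := sG; rewrite subsetD1 => /andP[sGE eG].
apply: matroid_eq => [|A]; first by rewrite /= [ground M :&: _](setIidPr _) ?subD1set // setDDl.
rewrite !rank_contraction cl // (rank_deletion sG).
have -> : rank M (A :|: (e |: G)) = (rank (deletion M e) (A :|: G)).+1.
  rewrite ffunE -cl; last by rewrite !inE eqxx andbF.
  rewrite -[LHS]rank_trace -[RHS]rank_trace; congr (rank M _).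
  apply/setP => x; rewrite !inE; case: eqP => [->|_] /=; first by rewrite orbT.
  by case: (x \in ground M); rewrite ?andbF ?andbT.
by rewrite subSS.
Qed.

Lemma coloop_localization M e G : coloop M e -> G \subset ground M :\ e ->
  coloop (localization M (e |: G)) e.
Proof.
move=> [eE cl]; rewrite subsetD1 => /andP[sG eG]; split; first by rewrite !inE eqxx eE.
move=> A eA; rewrite !ffunE -cl ?inE ?negb_and ?eA //; congr (rank M _).
by apply/setP => x; rewrite !inE; case: eqP.
Qed.

Lemma deletion_localization M e G : coloop M e -> G \subset ground M :\ e ->
  deletion (localization M (e |: G)) e = localization (deletion M e) G.
Proof.
move=> [eE _] sG; have := sG; rewrite subsetD1 => /andP[sGE eG].
rewrite /deletion ground_localization ?subUset ?sub1set ?eE // setU1K //.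
by rewrite !localization_localization ?subsetUr.
Qed.

Lemma charpoly_coloop M e : coloop M e ->
  charpoly M = ('X - 1) * charpoly (deletion M e).
Proof.
move=> cl; have [eE rU] := cl.
rewrite /charpoly (sum_subsets_split e) mulrBl mul1r (rk_deletion cl).
rewrite ground_deletion big_distrr /= -sumrN; congr (_ + _).
  apply: eq_big => [A|A]; first by rewrite subsetD1.
  rewrite -subsetD1 => sA; rewrite -scalerAr -exprS rank_deletion //; congr (_ *: 'X^_).
  by rewrite subSn // -(rank_deletion sA) rank_le_rk.
apply: eq_big => [A|A]; rewrite subUset sub1set eE /= -subsetD1 // => sA.
have nA : e \notin A by move: sA; rewrite subsetD1 => /andP[].
by rewrite cardsU1 nA rU // exprS mulN1r scaleNr subSS rank_deletion.
Qed.

End Coloop.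

Lemma reversalS r (p : {poly int}) : (size p <= r.+1)%N ->
  reversal r.+1 p = 'X * reversal r p.
Proof.
move=> sp; rewrite -[p in LHS]mul1r -add1n reversalM ?size_poly1 //.
by congr (_ * _); rewrite -(expr0 'X) reversalXn.
Qed.

Lemma reversalB r (p q : {poly int}) :
  reversal r (p - q) = reversal r p - reversal r q.
Proof. by rewrite reversalD -scaleN1r reversalZ scaleN1r. Qed.

Section ColoopKL.
Variable T : finType.
Implicit Types (M : matroid T) (G : {set T}) (e : T).

Lemma degree_deletion (P : matroid_invariant) M e :
  KL_rank0 P -> KL_degree P -> coloop M e ->
  ((size (P T (deletion M e))).-1.*2 < rk M)%N.
Proof.
move=> P0 Pd cl; rewrite (rk_deletion cl).
have [r0|r0] := posnP (rk (deletion M e)); last exact/ltnW/Pd.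
by have := size_KL_invariant (deletion M e) P0 Pd; rewrite r0; lia.
Qed.

(** The difference [d] of the two sides has low degree, and comparing the recursions shows that it
    equals its own reversal, or has zero reversal if there are loops; either way it vanishes. *)
Lemma KL_coloop M e : coloop M e -> KL M = KL (deletion M e).
Proof.
have [K0 Kd Kr] := KL_spec.
have [m] := ubnP #|ground M|; elim: m M => // m IH M ltm cl.
have k0 : (0 < rk M)%N by rewrite (rk_deletion cl).
set N := deletion M e; apply/eqP; rewrite -subr_eq0; apply/eqP.
set d := KL M - KL N.
have sd : ((size d).-1.*2 < rk M)%N.
  by apply: KL_degreeB; [exact: Kd | exact: degree_deletion].
suff rd : reversal (rk M) d = if set0 \in flats N then d else 0.
  case: ifP rd => _ rd; first exact: reversal_fixed k0 sd rd.
  rewrite -(@reversalK (rk M) d) ?rd ?reversal0 //.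
  by move: (size _) sd => s; lia.
rewrite reversalB Kr (sum_flats_coloop _ cl).
rewrite (rk_deletion cl) reversalS ?size_KL_invariant // Kr big_distrr /= -sumrB.
(* By induction the flats [G] and [e |: G] cancel against the term of [N] with weights 1, ['X - 1]
   and [- 'X]; only the empty [G], whose contraction is [M], escapes the induction and leaves
   [d]. *)
have term G : G \in flats N ->
    charpoly (localization M G) * KL (contraction M G) +
    charpoly (localization M (e |: G)) * KL (contraction M (e |: G)) -
    'X * (charpoly (localization N G) * KL (contraction N G)) =
    if G == set0 then d else 0.
  move=> fG; have sG := flat_deletion_sub fG.
  rewrite (charpoly_coloop (coloop_localization cl sG)) deletion_localization //.
  rewrite contractionU1_coloop // localization_localization //.
  case: eqP => [G0|/eqP G0].
    rewrite G0 !contraction_set0 [charpoly _]charpoly_empty; last first.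
      by rewrite ground_localization ?sub0set.
    by rewrite /d -/N; ring.
  rewrite (IH (contraction M G)); first by rewrite deletion_contraction -/N //; ring.
    have sGE := subset_trans sG (subD1set _ _).
    rewrite /= cardsD (setIidPr sGE); move: G0; rewrite -card_gt0.
    have := subset_leq_card sGE; lia.
  exact: coloop_contraction.
rewrite (eq_bigr _ term) -big_mkcondr /=.
case: ifP => f0; last by rewrite big_pred0 // => G; case: eqP => [->|]; rewrite ?f0 ?andbF.
by rewrite (big_pred1 set0) // => G /=; case: eqP => [->|]; rewrite ?f0 ?andbF.
Qed.

Lemma Zpoly_coloop M e : coloop M e ->
  Zpoly M = (1 + 'X) * Zpoly (deletion M e).
Proof.
move=> cl; rewrite /Zpoly (sum_flats_coloop _ cl) big_distrr /=.
apply: eq_bigr => G fG; have sG := flat_deletion_sub fG.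
have eG : e \notin G by move: sG; rewrite subsetD1 => /andP[].
rewrite contractionU1_coloop // (KL_coloop (coloop_contraction cl sG)).
rewrite deletion_contraction // (rank_deletion sG).
by case: cl => _ ->; rewrite // exprS mulrDl mul1r mulrA.
Qed.

Lemma inverse_KL_coloop M e : coloop M e -> inverse_KL M = inverse_KL (deletion M e).
Proof.
have [K0 Kd Kr] := inverse_KL_spec.
have [m] := ubnP #|ground M|; elim: m M => // m IH M ltm cl.
have k0 : (0 < rk M)%N by rewrite (rk_deletion cl).
set N := deletion M e; apply/eqP; rewrite -subr_eq0; apply/eqP.
set d := inverse_KL M - inverse_KL N.
have sd : ((size d).-1.*2 < rk M)%N.
  by apply: KL_degreeB; [exact: Kd | exact: degree_deletion].
apply: (reversal_fixed k0 sd); apply: (can_inj (signrZK (rk M))).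
rewrite reversalB scalerBr Kr (sum_flats_coloop _ cl).
rewrite (rk_deletion cl) reversalS ?size_KL_invariant // -/N.
set r := rk N.
have -> : (-1) ^+ r.+1 *: ('X * reversal r (inverse_KL N)) =
    - ('X * ((-1) ^+ r *: reversal r (inverse_KL N))).
  by rewrite exprS mulN1r scaleNr -scalerAr.
rewrite Kr opprK big_distrr -big_split /=.
have rev1 : reversal 1 ('X - 1) = 1 - 'X.
  by rewrite reversalB -(expr0 'X) -['X]expr1 !reversalXn.
(* Same cancellation with weights [1 - 'X], -1 and ['X]. The exception is now [G = ground N], since
   [e |: G] then localizes to [M]; it is always a flat, so loops need no separate case. *)
have term G : G \in flats N ->
    (-1) ^+ rank M G *: (inverse_KL (localization M G) *
       reversal (r.+1 - rank M G) (charpoly (contraction M G))) +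
    (-1) ^+ rank M (e |: G) *: (inverse_KL (localization M (e |: G)) *
       reversal (r.+1 - rank M (e |: G)) (charpoly (contraction M (e |: G)))) +
    'X * ((-1) ^+ rank N G *: (inverse_KL (localization N G) *
       reversal (r - rank N G) (charpoly (contraction N G)))) =
    if G == ground N then (-1) ^+ r.+1 *: d else 0.
  move=> fG; have sG := flat_deletion_sub fG.
  have eG : e \notin G by move: sG; rewrite subsetD1 => /andP[].
  have rG : (rank N G <= r)%N by exact: rank_le_rk.
  have rU : rank M (e |: G) = (rank N G).+1.
    by rewrite (rank_deletion sG); case: cl => _ ->.
  rewrite -(rank_deletion sG) rU subSS subSn // -add1n.
  rewrite (charpoly_coloop (coloop_contraction cl sG)) deletion_contraction //.
  rewrite contractionU1_coloop // -/N reversalM; first last.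
  - by rewrite -rk_contraction ?size_charpoly // flat_sub.
  - by rewrite -polyC1 size_XsubC.
  rewrite rev1 exprS mulN1r scaleNr.
  have <- : localization N G = localization M G by exact: localization_localization.
  case: eqP => [GE|/eqP GE].
    have -> : e |: G = ground M.
      by rewrite GE ground_deletion setD1K //; case: cl.
    rewrite GE !localization_ground -/(rk N) -/r subnn.
    rewrite [charpoly _]charpoly_empty ?[ground _]setDv // reversal01.
    rewrite exprS mulN1r scaleNr -!mul_polyC /d.
    by move: (((-1) ^+ r)%:P) => c; ring.
  rewrite (IH (localization M (e |: G))); last exact: coloop_localization.
    rewrite deletion_localization // -/N -!mul_polyC.
    by move: (((-1) ^+ rank N G)%:P) => c; ring.
  have [eE _] := cl; have sGE := subset_trans sG (subD1set _ _).
  rewrite ground_localization ?subUset ?sub1set ?eE //.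
  have := proper_card (_ : G \proper ground N); rewrite properEneq GE flat_sub //.
  move=> /(_ isT); rewrite ground_deletion cardsU1 eG.
  by move: ltm; rewrite (cardsD1 e (ground M)) eE; lia.
rewrite (eq_bigr _ term) -big_mkcondr /= (big_pred1 (ground N)) // => G /=.
by apply/andP/eqP => [[_ /eqP] // | ->]; split; first exact: ground_flat.
Qed.

End ColoopKL.

(** * The test matroid: a uniform matroid plus a coloop *)

Section UniformPlusColoop.
Variables (T : finType) (e : T) (j : nat).
Implicit Types A B H : {set T}.

Lemma uniform_coloop_subproof :
  rank_axioms [set: T]
    [ffun A : {set T} => ((e \in A) + minn #|A :\ e| j)%N].
Proof.
apply/and4P; split; apply/forallP => A; rewrite ?ffunE ?setIT //.
- by rewrite (cardsD1 e A) leq_add2l geq_minl.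
- apply/forallP => B; rewrite !ffunE; apply/implyP => sAB.
  have le : (#|A :\ e| <= #|B :\ e|)%N by exact/subset_leq_card/setSD.
  have := subsetP sAB e; case: (e \in A) => [/(_ isT) ->|_ ]; last first.
    by case: (e \in B) => /=; lia.
  by rewrite leq_add2l; lia.
- apply/forallP => B; rewrite !ffunE !inE.
  have := cardsUI (A :\ e) (B :\ e); rewrite -setDUl -setDIl.
  have leA : (#|(A :&: B) :\ e| <= #|A :\ e|)%N.
    by apply/subset_leq_card/setSD/subsetIl.
  have leB : (#|(A :&: B) :\ e| <= #|B :\ e|)%N.
    by apply/subset_leq_card/setSD/subsetIr.
  by case: (e \in A); case: (e \in B) => /=; lia.
Qed.

(* The direct sum of U_{j,#|T|-1} and the coloop e. It is the test matroid
   that detects [g]: it is paving with a single dependent hyperplane, T :\ e. *)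
Definition uniform_coloop : matroid T := Matroid uniform_coloop_subproof.

Lemma rank_uniform_coloop A :
  rank uniform_coloop A = ((e \in A) + minn #|A :\ e| j)%N.
Proof. by rewrite ffunE. Qed.

Lemma coloop_uniform_coloop : coloop uniform_coloop e.
Proof.
split=> [|A eA]; first by rewrite inE.
by rewrite !rank_uniform_coloop setU11 (negPf eA) setU1K // (setDidPl _) ?disjoints1 // disjoint_sym disjoints1.
Qed.

Lemma card_setTD1 : #|[set: T] :\ e| = #|T|.-1.
Proof. by rewrite -cardsT (cardsD1 e [set: T]) inE. Qed.

Lemma rk_uniform_coloop : (j < #|T|)%N -> rk uniform_coloop = j.+1.
Proof. by move=> lt_jT; rewrite /rk rank_uniform_coloop inE card_setTD1; lia. Qed.

Lemma rank_paving_uniform_coloop : (j < #|T|)%N -> rank_paving uniform_coloop.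
Proof.
move=> lt_jT A _; rewrite rk_uniform_coloop // rank_uniform_coloop => lt.
by move: lt; rewrite (cardsD1 e A); case: (e \in A) => /= lt; lia.
Qed.

Lemma rank_deletion_uniform_coloop A : A \subset [set: T] :\ e ->
  rank uniform_coloop A = minn #|A| j.
Proof.
rewrite subsetD1 => /andP[_ eA]; rewrite rank_uniform_coloop (negPf eA).
by have := cardsD1 e A; rewrite (negPf eA) => ->.
Qed.

(** The deletion is a localization of a paving matroid at a set of rank one less, so additivity
    alone carries the value over to the ordinal type. *)
Lemma deletion_uniform_coloop (f : matroid_invariant) :
  (j < #|T|)%N -> hyp_additive j f ->
  f _ (deletion uniform_coloop e) = f _ (uniform j #|T|.-1).
Proof.
move=> lt_jT fA.
have rE : rank uniform_coloop ([set: T] :\ e) = j.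
  by rewrite rank_deletion_uniform_coloop // card_setTD1; lia.
rewrite (hyp_additive_localization fA) ?subD1set ?card_setTD1 //.
  exact: rank_paving_uniform_coloop.
by rewrite rk_uniform_coloop.
Qed.

Lemma dep_hyperplanes_uniform_coloop : (j < #|T|.-1)%N ->
  dep_hyperplanes uniform_coloop = [set [set: T] :\ e].
Proof.
move=> ltjh; have lt_jT : (j < #|T|)%N by apply: leq_trans ltjh (leq_pred _).
apply/setP => H; rewrite !inE rk_uniform_coloop //.
apply/andP/eqP => [[hH cH] | ->].
  have := hyperplane_rank hH; rewrite rk_uniform_coloop // => -[rH].
  (* A hyperplane through [e] has only [j] elements, one too few to be dependent. *)
  have eH : e \notin H.
    apply/negP => eH; move: rH; rewrite rank_uniform_coloop eH.
    by have := cardsD1 e H; rewrite eH; lia.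
  apply/eqP; rewrite eqEsubset subsetD1 subsetT eH /=; apply/subsetP => x.
  (* [H] already has more than [j] elements, so adding a further [x] other than [e] would not raise
     its rank. *)
  rewrite !inE andbT => xe; apply: contraT => xH.
  have fH : flat uniform_coloop H by case/andP: hH.
  have := flat_rankU1 fH (in_setT x) xH.
  rewrite rH rank_uniform_coloop !inE eq_sym (negPf xe) (negPf eH) /=; lia.
rewrite card_setTD1; split=> //; rewrite /hyperplane rk_uniform_coloop //.
rewrite rank_deletion_uniform_coloop // card_setTD1.
have f : [set: T] :\ e \in flats uniform_coloop.
  have := ground_flat (deletion uniform_coloop e).
  rewrite flats_deletion; last exact: coloop_uniform_coloop.
  by rewrite ground_deletion inE => /andP[].
by move: f; rewrite inE => -> /=; rewrite eqSS; apply/eqP/minn_idPr/ltnW.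
Qed.

End UniformPlusColoop.

(** * Identification of the coefficients and conclusion *)

(** The test matroid on h + 1 elements has value a(h + 1) - g(h), while [uniform k h.+1] has value
    a(h + 1), so g(h) is their difference. *)
Lemma hyp_additive_formula k (f : matroid_invariant) (T : finType)
    (M : matroid T) : hyp_additive k f -> rank_paving M -> rk M = k ->
  f T M = f _ (uniform k #|ground M|) -
    \sum_(H in dep_hyperplanes M)
      (f _ (uniform k #|H|.+1) - f _ (uniform_coloop (ord0 : 'I_#|H|.+1) k.-1)).
Proof.
move=> fA pM kM; have [a [g fE]] := fA.
have le := rk_le_card M; rewrite kM in le.
have fU n : (k <= n)%N -> f _ (uniform k n) = a n.
  move=> len; rewrite fE ?rk_uniform ?dep_hyperplanes_uniform ?big_set0 ?subr0 //.
    by rewrite cardsT card_ord.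
  exact: rank_paving_uniform.
rewrite fE // fU //; congr (_ - _); apply: eq_bigr => H.
(* A hyperplane forces k to be positive, so [k.-1] is a genuine predecessor wherever it is used. *)
rewrite inE kM => /andP[hH leH]; have := hyperplane_rank hH; rewrite kM => rH.
have lt : (k.-1 < #|H|)%N by rewrite -rH in leH *.
rewrite fU ?(leq_trans leH) // fE; first last.
- by rewrite rk_uniform_coloop ?card_ord ?ltnS ?(ltnW lt) // -rH.
- by apply: rank_paving_uniform_coloop; rewrite card_ord ltnS ltnW.
rewrite dep_hyperplanes_uniform_coloop ?card_ord ?ltnS ?(ltnW lt) //.
rewrite big_set1 card_setTD1 card_ord.
by rewrite cardsT card_ord subKr.
Qed.

(** Grouping by size; the upper summation bound loses nothing because hyperplanes lie in the ground
    set. *)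
Lemma sum_num_hyperplanes (T : finType) (M : matroid T) (c : nat -> {poly int}) :
  \sum_(rk M <= h < #|ground M|.+1) c h *+ num_hyperplanes M h =
  \sum_(H in dep_hyperplanes M) c #|H|.
Proof.
set k := rk M; set n := #|ground M|.
have dH (H : {set T}) : H \in dep_hyperplanes M -> (k <= #|H| < n.+1)%N.
  by rewrite inE => /andP[/hyperplane_sub/subset_leq_card cH ->].
rewrite big_nat_cond.
transitivity (\sum_(k <= h < n.+1 | (k <= h < n.+1)%N && true)
   \sum_(H in dep_hyperplanes M | #|H| == h) c #|H|).
  apply: eq_bigr => h /andP[/andP[lekh _] _]; rewrite -sumr_const.
  apply: eq_big => [H|H]; rewrite inE; last by case/andP=> _ /eqP->.
  by rewrite [in RHS]inE -andbA; congr (_ && _); case: eqP => [->|]; rewrite ?lekh ?andbF.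
rewrite -big_nat_cond (exchange_big_dep (mem (dep_hyperplanes M))) /=; last first.
  by move=> h H _ /andP[].
apply: eq_bigr => H dMH; under eq_bigl do rewrite dMH eq_sym /=.
by rewrite big_nat1_eq dH.
Qed.

Theorem theorem4p4 (T : finType) (M : matroid T) (k n : nat)
    (paving_M : paving M) (rk_M : rk M = k) (card_M : #|ground M| = n) :
  [/\ KL M = KL (uniform k n)
             - \sum_(k <= h < n.+1) p_poly k h *+ num_hyperplanes M h,
      inverse_KL M = inverse_KL (uniform k n)
             - \sum_(k <= h < n.+1) q_poly k h *+ num_hyperplanes M h
    & Zpoly M = Zpoly (uniform k n)
             - \sum_(k <= h < n.+1) z_poly k h *+ num_hyperplanes M h].
Proof.
have pM := pavingW paving_M; rewrite -card_M -rk_M !sum_num_hyperplanes.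
have lt H : H \in dep_hyperplanes M -> ((rk M).-1 < #|'I_#|H|.+1|)%N.
  rewrite inE card_ord ltnS => /andP[_ ?]; lia.
have cl (H : {set T}) := coloop_uniform_coloop (ord0 : 'I_#|H|.+1) (rk M).-1.
split; [rewrite (hyp_additive_formula (hyp_additive_KL _) pM erefl)
       |rewrite (hyp_additive_formula (hyp_additive_inverse_KL _) pM erefl)
       |rewrite (hyp_additive_formula (hyp_additive_Zpoly _) pM erefl)];
  congr (_ - _); apply: eq_bigr => H dH; congr (_ - _).
(* In each case, removing the coloop from the test matroid leaves the value at
   [uniform (rk M).-1 #|H|], with the extra factor [1 + 'X] for Z. *)
- rewrite (KL_coloop (cl H)).
  by rewrite (deletion_uniform_coloop _ (lt H dH) (hyp_additive_KL _)) card_ord.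
- rewrite (inverse_KL_coloop (cl H)).
  by rewrite (deletion_uniform_coloop _ (lt H dH) (hyp_additive_inverse_KL _)) card_ord.
- rewrite (Zpoly_coloop (cl H)).
  by rewrite (deletion_uniform_coloop _ (lt H dH) (hyp_additive_Zpoly _)) card_ord.
Qed.
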